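(* Let $d=1$ and let $\Lambda:L^r(\Omega)\rightrightarrows L^s(\Omega)$ be a multivalued (drag) operator with $\Lambda(u)\neq\emptyset$ for all $u\in L^r(\Omega)$. Consider Problem (P): find $(u,p)\in L^r(\Omega)\times W_0^{1,s}(\Omega)$ such that there exists $\lambda\in\Lambda(u)$ with $$\langle\lambda,\varphi\rangle=\langle-p'+f_0,\varphi\rangle\quad\forall\varphi\in L^r(\Omega),\qquad \langle\psi',u\rangle=-\int_\Omega q\psi+\int_{\Sigma_{\mathrm v}}u_0\psi\quad\forall\psi\in W_0^{1,s}(\Omega).$$ (i) If $\mathrm{Vol}^0(\Sigma_{\mathrm v})>0$, then Problem (P) has a solution $(u,p)$ such that $u$ is unique. If moreover $\Lambda$ is monovalued, then $p$ also is unique. (ii) If $\mathrm{Vol}^0(\Sigma_{\mathrm v})=0$, suppose that $\Lambda$ is set-continuous, that $\Lambda(u)$ is a convex set for all $u\in L^r(\Omega)$, and that $\Lambda$ is $\sigma$-coercive and $\sigma$-bounded for some $\sigma\geq1$. Then Problem (P) has a solution.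
   Context: Setting (dimension $d=1$). $\Omega\subset\mathbb{R}$ is open, bounded, with Lipschitz boundary $\partial\Omega$ (the one-dimensional porous medium). $\Sigma_{\mathrm v},\Sigma_{\mathrm p}\subset\partial\Omega$ are relatively open in $\partial\Omega$, with $\partial\Omega=\overline{\Sigma_{\mathrm v}\cup\Sigma_{\mathrm p}}$ and $\Sigma_{\mathrm v}\cap\Sigma_{\mathrm p}=\emptyset$. $\mathrm{Vol}^0$ is the $0$-dimensional (counting) measure. $r\in(1,\infty)$ and $s=r/(r-1)$; $\|\cdot\|_\beta$ is the norm of $L^\beta(\Omega)$ and $\langle\cdot,\cdot\rangle$ is the canonical dual pairing on $L^s(\Omega)\times L^r(\Omega)$. The integral over $\Sigma_{\mathrm v}$ is with respect to $\mathrm{Vol}^0$. Data: $q\in L^r(\Omega)$, $f\in L^s(\Omega)$, $u_0\in L^r(\Sigma_{\mathrm v})$, $p_0\in W^{\frac1r,s}(\Sigma_{\mathrm p})$. $f_0=f$ if $\mathrm{Vol}^0(\Sigma_{\mathrm p})=0$, and $f_0=f-(Ep_0)'$ if $\mathrm{Vol}^0(\Sigma_{\mathrm p})>0$, where $E$ is any extension operator from data on $\Sigma_{\mathrm p}$ to $W^{1,s}(\Omega)$ that is a right inverse of the trace operator. $W_0^{1,s}(\Omega)=\{\xi\in W^{1,s}(\Omega):\frac1{|\Omega|}\int_\Omega\xi=0\}$ if $\mathrm{Vol}^0(\Sigma_{\mathrm p})=0$, and $W_0^{1,s}(\Omega)=\{\xi\in W^{1,s}(\Omega):\xi=0\text{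 on }\Sigma_{\mathrm p}\}$ if $\mathrm{Vol}^0(\Sigma_{\mathrm p})>0$; it is normed by $\psi\mapsto\|\psi'\|_s$. Operators. The graph of $\Lambda$ is $\mathrm{Gr}(\Lambda)=\{(u,\lambda):\lambda\in\Lambda(u)\}$. - Set-continuous: for every sequence $(u_n)_n\subset L^r(\Omega)$ converging to some $u\in L^r(\Omega)$, one has $\mathrm{dist}(\Lambda(u_n),\Lambda(u))\to0$, i.e., there exists a sequence $(\lambda_n)_n\subset L^s(\Omega)$ with $\lambda_n\in\Lambda(u_n)$ for all $n$ converging to an element of $\Lambda(u)$. - $\sigma$-coercive: there is $c:[0,\infty)\to\mathbb{R}$ with $c(a)\to\infty$ as $a\to\infty$ and $\langle\lambda,u\rangle\geq c(\|u\|_r)\|u\|_r^\sigma$ for all $(u,\lambda)\in\mathrm{Gr}(\Lambda)$. - $\sigma$-bounded: there is $C>0$ with $\|\lambda\|_s\leq C(1+\|u\|_r^\sigma)$ for all $(u,\lambda)\in\mathrm{Gr}(\Lambda)$. - Monovalued: $\Lambda(u)$ is a singleton for every $u$.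
   Formalization: Ω is additionally assumed nonempty and connected (an interval); for disconnected Ω the claim fails, e.g. Ω=(0,1)∪(2,3), Σ_v={0}, Σ_p={1,2,3}, Λ={0}, zero data, where u is not unique. *)

(* Defs.v *)
From HB Require Import structures.
From mathcomp Require Import all_boot all_order all_algebra.
From mathcomp Require Import all_classical all_reals all_analysis.
Set Implicit Arguments.
Unset Strict Implicit.
Unset Printing Implicit Defensive.
Import Order.TTheory GRing.Theory Num.Theory.
Import numFieldNormedType.Exports.
Local Open Scope classical_set_scope.
Local Open Scope ring_scope.

Definition boundary {T : topologicalType} (A : set T) : set T :=
  closure A `\` A°.

Definition relatively_open {T : topologicalType} (B S : set T) : Prop :=
  exists2 U : set T, open U & S = B `&` U.

(* In dimension one a Lipschitz graph is a point, so that near a boundary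
   point the set coincides with one of the two half-lines. *)
Definition lipschitz_boundary {R : realType} (Omega : set R) : Prop :=
  forall x, boundary Omega x -> exists2 e : R, 0 < e &
    Omega `&` `](x - e), (x + e)[%classic = `]x, (x + e)[%classic \/
    Omega `&` `](x - e), (x + e)[%classic = `](x - e), x[%classic.

Definition Vol0 {R : realType} (S : set R) : \bar R := @counting R R S.

Definition conj_exp {R : realType} (r : R) : R := r / (r - 1).

Fact gt1_leE {R : realType} {r : R} (hr : 1 < r) : (1 <= r%:E)%E.
Proof. by rewrite lee_fin ltW. Qed.

Fact conj_gt1_leE {R : realType} {r : R} (hr : 1 < r) :
  (1 <= (conj_exp r)%:E)%E.
Proof.
by rewrite lee_fin /conj_exp ler_pdivlMr ?subr_gt0// mul1r gerBl.
Qed.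

Definition test_function {R : realType} (Omega : set R) (phi : R -> R) : Prop :=
  [/\ forall (n : nat) (x : R), derivable (derive1n n phi) x 1,
      compact (closure [set x | phi x != 0]) &
      closure [set x | phi x != 0] `<=` Omega].

Section boundary_data.
Context {R : realType}.
Implicit Types (S : set R) (g : R -> R) (theta p : R).

Definition mem_Lp0 S p g : Prop :=
  measurable_fun S g /\
  (\int[@counting R R]_(x in S) (`|g x| `^ p)%:E < +oo)%E.

(* Sobolev-Slobodeckij space on a 0-dimensional set: the exponent in the
   denominator is dim + theta * p with dim = 0; on the diagonal the quotient
   is 0 / 0 = 0. *)
Definition mem_W0dim S theta p g : Prop :=
  mem_Lp0 S p g /\
  (\int[@counting R R]_(x in S) \int[@counting R R]_(y in S)
     (`|g x - g y| `^ p / `|x - y| `^ (theta * p))%:E < +oo)%E.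

End boundary_data.

Section spaces.
Context {R : realType} {Omega : set R} (oOmega : open Omega).

Definition leb : {measure set (measurableTypeR R) -> \bar R} :=
  mrestr lebesgue_measure (measurable_realfun.open_measurable oOmega).

(* the space L^p(Omega), quotiented by equality almost everywhere *)
Definition Leb (p : R) (p1 : (1 <= p%:E)%E) := LspaceType leb p1.

Definition Leb_fun (p : R) (p1 : (1 <= p%:E)%E) (f : Leb p1) : R -> R := f.

Definition Lnrm (p : R) (f : R -> R) : R := fine ('N[leb]_(p%:E)[EFin \o f])%E.

Definition pairing (f g : R -> R) : R := \int[leb]_x (f x * g x).

Definition weak_derivative (f g : R -> R) : Prop :=
  forall phi : R -> R, test_function Omega phi ->
    pairing f (derive1 phi) = - pairing g phi.

End spaces.

Coercion Leb_fun : Leb >-> Funclass.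

Section sobolev.
Context {R : realType} {Omega : set R} (oOmega : open Omega).
Context (p : R) (p1 : (1 <= p%:E)%E).

(* W^{1,p}(Omega); the derivative, being unique, is bundled with the function *)
Record W1 := MkW1 {
  W1_fun : Leb oOmega p1 ;
  W1_der : Leb oOmega p1 ;
  W1_derP : weak_derivative oOmega W1_fun W1_der }.

(* In dimension one the elements of W^{1,p} have a representative which is
   continuous up to the boundary; its values on the closure of Omega are
   uniquely determined, and the trace is its restriction to the boundary. *)
Definition continuous_representative (f : W1) : R -> R :=
  xget (cst 0) [set g : R -> R | {within closure Omega, continuous g} /\
    {ae leb oOmega, forall x, g x = W1_fun f x}].

Definition trace (f : W1) (x : R) : R := continuous_representative f x.

Definition W1_0 (Sigma_p : set R) (f : W1) : Prop :=
  if Vol0 Sigma_p == 0%E then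
    (fine (lebesgue_measure Omega))^-1 * (\int[leb oOmega]_x W1_fun f x) = 0
  else forall x, Sigma_p x -> trace f x = 0.

End sobolev.

Section operators.
Context {R : realType} {Omega : set R} (oOmega : open Omega).
Context (r : R) (hr : 1 < r).
Local Notation s := (conj_exp r).
Local Notation Lr := (Leb oOmega (gt1_leE hr)).
Local Notation Ls := (Leb oOmega (conj_gt1_leE hr)).
Local Notation W1s := (W1 oOmega (conj_gt1_leE hr)).
Local Notation "''<' f , g >" := (pairing oOmega f g)
  (at level 0, f at level 40, g at level 40).

Definition Leb_cvg (p : R) (p1 : (1 <= p%:E)%E)
    (f_ : nat -> Leb oOmega p1) (f : Leb oOmega p1) : Prop :=
  Lnrm oOmega p (fun x => f_ n x - f x) @[n --> \oo] --> (0 : R).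

Definition set_continuous (Lambda : Lr -> set Ls) : Prop :=
  forall (u_ : nat -> Lr) (u : Lr), Leb_cvg u_ u ->
    exists (lam_ : nat -> Ls) (lam : Ls),
      [/\ forall n, Lambda (u_ n) (lam_ n), Lambda u lam & Leb_cvg lam_ lam].

Definition sigma_coercive (sigma : R) (Lambda : Lr -> set Ls) : Prop :=
  exists2 c : R -> R, c a @[a --> +oo] --> +oo &
    forall (u : Lr) (lam : Ls), Lambda u lam ->
      c (Lnrm oOmega r u) * Lnrm oOmega r u `^ sigma <= '<lam, u>.

Definition sigma_bounded (sigma : R) (Lambda : Lr -> set Ls) : Prop :=
  exists2 C : R, 0 < C & forall (u : Lr) (lam : Ls), Lambda u lam ->
    Lnrm oOmega s lam <= C * (1 + Lnrm oOmega r u `^ sigma).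

Definition monovalued (Lambda : Lr -> set Ls) : Prop :=
  forall u, exists lam, Lambda u = [set lam].

Definition convex_subset (A : set Ls) : Prop :=
  forall (lam1 lam2 lam : Ls) (t : R), A lam1 -> A lam2 -> 0 <= t <= 1 ->
    {ae leb oOmega, forall x, lam x = t * lam1 x + (1 - t) * lam2 x} -> A lam.

(* E only depends on the values of the data on Sigma_p *)
Definition extension_operator (Sigma_p : set R) (E : (R -> R) -> W1s) : Prop :=
  (forall g h : R -> R, {in Sigma_p, g =1 h} -> E g = E h) /\
  (forall g : R -> R, mem_W0dim Sigma_p r^-1 s g ->
     forall x, Sigma_p x -> trace (E g) x = g x).

Definition f0 (Sigma_p : set R) (f : Ls) (p0 : R -> R) (E : (R -> R) -> W1s)
    : R -> R :=
  if Vol0 Sigma_p == 0%E then (f : R -> R) else fun x => f x - W1_der (E p0) x.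

Definition problemP (Sigma_v Sigma_p : set R) (Lambda : Lr -> set Ls)
    (q : Lr) (f : Ls) (u0 p0 : R -> R) (E : (R -> R) -> W1s)
    (u : Lr) (p : W1s) : Prop :=
  W1_0 Sigma_p p /\
  exists lam : Ls,
    [/\ Lambda u lam,
        forall phi : Lr,
          '<lam, phi> = '<fun x => - W1_der p x + f0 Sigma_p f p0 E x, phi> &
        forall psi : W1s, W1_0 Sigma_p psi ->
          '<W1_der psi, u> = - (\int[leb oOmega]_x (q x * W1_fun psi x))
            + \int[@counting R R]_(x in Sigma_v) (u0 x * trace psi x)].

End operators.

(* Main.v *)
Require Import Defs.
From HB Require Import structures.
From mathcomp Require Import all_boot all_order all_algebra.
From mathcomp Require Import all_classical all_reals all_analysis.
From mathcomp Require Import measurable_realfun ring lra.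
From mathcomp Require finmap.
Import Order.TTheory GRing.Theory Num.Theory.
Import numFieldNormedType.Exports.
Set Implicit Arguments.
Unset Strict Implicit.
Unset Printing Implicit Defensive.
Local Open Scope classical_set_scope.
Local Open Scope ring_scope.

(** Omega is an interval ]a, b[, and psi in W^{1,p}(Omega) is of the form
psi(x) = psi(a) + \int_a^x psi' (du Bois-Reymond), so everything can be expressed
through psi(a) and the arbitrary function psi'.  If Sigma_v is nonempty, the
constraint defining W_0^{1,s} fixes psi(a) as - \int psi' kappa for a kernel kappa;
integrating the source term by parts turns the continuity equation into
<psi', u> = <psi', U> for all psi', whence u = U, and any lambda in Lambda(u)
gives p' = f_0 - lambda.  If Sigma_v is empty, psi' ranges over the functions of
zero mean, so u = Q + c with Q a primitive of q and c a free constant, and a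
pressure vanishing at both ends exists iff some lambda in Lambda(Q + c) has
\int lambda = \int f_0.  The map c |-> { \int lambda | lambda in Lambda(Q + c) } is
interval-valued, continuous, and tends to +-oo with c by coercivity, so the
intermediate value theorem provides c. *)

(** * Smooth functions *)

Section smooth.
Context {R : realType}.
Implicit Types (f g : R -> R) (P : {poly R}).

(** The freedom of psi' in the whole of L^s is what makes the reduction effective: the indicators of
    [a, x] are admissible derivatives, and pairing with them evaluates a primitive at x, so
    functions are separated without any density argument. Smooth functions enter only through du
    Bois-Reymond, which needs a supply of compactly supported test functions; these are built from
    exp(-1/x). A single kernel requires an endpoint outside Sigma_p, which a nonempty Sigma_v
    disjoint from it provides. When Sigma_v is empty, coercivity controls <lambda, Q + c> and not c
    times the integral of lambda. The gap <lambda, Q> is at most a constant times 1 + N^sigma, with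
    N the L^r norm of Q + c, because Q is bounded and lambda is sigma-bounded; the coercivity factor
    tends to infinity and outweighs that constant. Since sigma is at least 1, what remains is at
    least of order N, which grows linearly in |c|. Elements of L^p are classes and traces are values
    of a chosen continuous representative, hence the repeated passage from identities almost
    everywhere to identities at every point of [a, b]. *)

Definition smooth f := forall (n : nat) (x : R), derivable (derive1n n f) x 1.

(** Induction on the order with the function left general: a derivative of order n + 1 is one of
    order n of f', again in [S]. Smoothness thus follows from stability under one differentiation,
    without formulas for iterated derivatives. *)
Lemma smooth_coind (S : set (R -> R)) :
  (forall f, S f -> (forall x, derivable f x 1) /\ S (derive1 f)) ->
  forall f, S f -> smooth f.
Proof.
move=> HS f Sf n; elim: n f Sf => [|n IH] f /HS[df Sdf] x; first exact: df.
by rewrite derive1Sn; exact: IH.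
Qed.

Lemma smooth_derivable f (x : R) : smooth f -> derivable f x 1.
Proof. by move=> /(_ 0%N x). Qed.

Lemma smooth_derive1 f : smooth f -> smooth (derive1 f).
Proof. by move=> sf n x; rewrite -derive1Sn. Qed.

Lemma smooth_cst (c : R) : smooth (cst c).
Proof.
apply: (smooth_coind (S := [set f | exists d : R, f = cst d])); last by exists c.
move=> _ [d ->]; split; first by move=> x; exact: derivable_cst.
by exists 0; apply/funext => x; rewrite derive1_cst.
Qed.

(** Differentiating a product yields a sum of products, so closure under one operation alone is not
    stable under differentiation. The joint closure is, and [smooth_coind] then applies to it. *)
Inductive smooth_alg : (R -> R) -> Prop :=
| SmoothBase f of smooth f : smooth_alg f
| SmoothAdd f g of smooth_alg f & smooth_alg g :
    smooth_alg (fun x => f x + g x)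
| SmoothMul f g of smooth_alg f & smooth_alg g :
    smooth_alg (fun x => f x * g x)
| SmoothAff f (m c : R) of smooth_alg f : smooth_alg (fun x => f (m * x + c)).

Lemma is_derive1E f (x df : R) : is_derive x 1 f df -> derive1 f x = df.
Proof. by move=> h; rewrite derive1E derive_val. Qed.

Lemma is_derive1_derive1 f (x : R) : derivable f x 1 -> is_derive x 1 f (derive1 f x).
Proof. by move=> h; rewrite derive1E; exact/derivableP. Qed.

Lemma is_derive_aff f (m c x : R) : derivable f (m * x + c) 1 ->
  is_derive x 1 (fun x => f (m * x + c)) (m * derive1 f (m * x + c)).
Proof.
move=> /is_derive1_derive1 df.
have daff : is_derive x 1 (fun x : R => m * x + c) m.
  have -> : (fun x : R => m * x + c) = (m *: id + cst c) by apply/funext => y.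
  by apply: is_derive_eq; rewrite addr0 /GRing.scale/= mulr1.
by rewrite mulrC; apply: (is_derive1_comp (f := f)).
Qed.

Lemma smooth_alg_smooth f : smooth_alg f -> smooth f.
Proof.
apply: smooth_coind f => f; elim => {f} [f sf|f g af [df sf'] ag [dg sg']|f g af [df sf'] ag [dg sg']|f m c af [df sf']].
- split; first by move=> x; exact: smooth_derivable.
  by apply: SmoothBase; exact: smooth_derive1.
- have d (x : R) : is_derive x 1 (fun x => f x + g x) (derive1 f x + derive1 g x).
    by apply: is_deriveD; exact: is_derive1_derive1.
  split; first by move=> x; have := d x => -[].
  rewrite (_ : derive1 _ = fun x => derive1 f x + derive1 g x); last first.
    by apply/funext => x; exact: is_derive1E.
  exact: SmoothAdd.
- have d (x : R) : is_derive x 1 (fun x => f x * g x)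
      (f x * derive1 g x + g x * derive1 f x).
    by apply: is_deriveM; exact: is_derive1_derive1.
  split; first by move=> x; have := d x => -[].
  rewrite (_ : derive1 _ = fun x => f x * derive1 g x + g x * derive1 f x).
    by apply: SmoothAdd; exact: SmoothMul.
  by apply/funext => x; exact: is_derive1E.
- have d (x : R) := is_derive_aff (df (m * x + c)).
  split; first by move=> x; have := d x => -[].
  rewrite (_ : derive1 _ = fun x => cst m x * derive1 f (m * x + c)).
    apply: SmoothMul; first exact/SmoothBase/smooth_cst.
    exact: SmoothAff.
  by apply/funext => x; exact: is_derive1E.
Qed.

(** A polynomial is at most B (1 + t^(n+1)) on the half-line, and exp t dominates this through the
    term t^(n+1)/(n+1)! of its series; hence the factorial in the bound. *)
Lemma expRN_poly_bounded P :
  exists C : R, forall t, 0 <= t -> `|P.[t]| * expR (- t) <= C.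
Proof.
elim/poly_ind : P => [|P c [C HC]].
  by exists 0 => t t0; rewrite horner0 normr0 mul0r.
suff [D HD] : exists D : R, forall t, 0 <= t -> `|(P * 'X).[t]| * expR (- t) <= D.
  exists (D + `|c|) => t t0; rewrite hornerD hornerC.
  apply: (@le_trans _ _ ((`|(P * 'X).[t]| + `|c|) * expR (- t))).
    by rewrite ler_wpM2r ?expR_ge0 ?ler_normD.
  rewrite mulrDl lerD ?HD// ler_piMr// -(expR0 R).
  by rewrite ler_expR oppr_le0.
have pow (Q : {poly R}) : exists n (B : R), forall t, 0 <= t -> `|Q.[t]| <= B * (1 + t ^+ n.+1).
  elim/poly_ind : Q => [|Q d [n [B HB]]].
    by exists 0%N, 0 => t _; rewrite horner0 normr0 mul0r.
  exists n.+1, (2 * `|B| + `|d|) => t t0.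
  rewrite hornerD hornerC hornerMX.
  apply: (le_trans (ler_normD _ _)); rewrite normrM (ger0_norm t0).
  have tn : 0 <= t ^+ n.+2 by exact: exprn_ge0.
  have : `|Q.[t]| * t <= `|B| * (1 + t ^+ n.+1) * t.
    apply: ler_wpM2r => //; apply: (le_trans (HB _ t0)).
    by rewrite ler_wpM2r ?ler_norm// addr_ge0// exprn_ge0.
  have : t + t ^+ n.+2 <= 2 * (1 + t ^+ n.+2).
    have [t1|t1] := leP t 1; first lra.
    have : t <= t ^+ n.+2 by rewrite -[X in X <= _]expr1 ler_eXn2l// ltW.
    lra.
  have : 0 <= `|d| * t ^+ n.+2 by rewrite mulr_ge0.
  have -> : `|B| * (1 + t ^+ n.+1) * t = `|B| * (t + t ^+ n.+2).
    by rewrite [in RHS]exprSr; ring.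
  move=> h1 h2 h3; apply: (@le_trans _ _ (`|B| * (t + t ^+ n.+2) + `|d|)).
    by rewrite lerD2r.
  have : `|B| * (t + t ^+ n.+2) <= `|B| * (2 * (1 + t ^+ n.+2)) by rewrite ler_wpM2l.
  nra.
have [n [B HB]] := pow (P * 'X).
exists (`|B| * (n.+1)`!%:R) => t t0.
have : `|(P * 'X).[t]| <= `|B| * (n.+1)`!%:R * (1 + t ^+ n.+1 / n.+1`!%:R).
  apply: (le_trans (HB _ t0)).
  have f0 : (n.+1`!%:R : R) != 0 by rewrite pnatr_eq0 -lt0n fact_gt0.
  have -> : `|B| * n.+1`!%:R * (1 + t ^+ n.+1 / n.+1`!%:R) =
      `|B| * (n.+1`!%:R + t ^+ n.+1) by field.
  have tn : 0 <= t ^+ n.+1 by exact: exprn_ge0.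
  apply: (@le_trans _ _ (`|B| * (1 + t ^+ n.+1))).
    by rewrite ler_wpM2r ?ler_norm// addr_ge0.
  by rewrite ler_wpM2l// lerD2r ler1n fact_gt0.
have := expR_ge1Dxn n t0 => h1 h2.
rewrite expRN ler_pdivrMr ?expR_gt0//; apply: (le_trans h2).
by rewrite ler_wpM2l// mulr_ge0.
Qed.

(* The factor P(1/x) makes the family stable under differentiation. *)
Definition flat P (x : R) : R := if 0 < x then P.[x^-1] * expR (- x^-1) else 0.

(** With y = 1/x, so that y' = -y^2, the derivative of P(y) exp(-y) is y^2 (P(y) - P'(y)) exp(-y).
    Only the origin needs an estimate. *)
Lemma is_derive_flat P (x : R) :
  is_derive x 1 (flat P) (flat ('X^2 * (P - P^`())) x).
Proof.
have [x0|x0|->] := ltgtP x 0.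
- have -> : flat ('X^2 * (P - P^`())) x = 0 by rewrite /flat ltNge ltW.
  apply: near_eq_is_derive (is_derive_cst (0 : R) x 1).
  near=> y; rewrite /flat ifF//; apply/negbTE; rewrite -leNgt ltW//.
  by near: y; exact: lt_nbhsl.
- have -> : flat ('X^2 * (P - P^`())) x =
    P.[x^-1] * (expR (- x^-1) * (- (- x^-2))) + expR (- x^-1) * (P^`().[x^-1] * (- x^-2)).
    by rewrite /flat x0 hornerM hornerXn hornerD hornerN -!exprVn; ring.
  have dV : is_derive x 1 (fun y : R => y^-1) (- x^-2).
    have := @is_deriveV R id x 1 1 (lt0r_neq0 x0) (is_derive_id x 1).
    by rewrite /GRing.scale/= mulr1.
  have dN : is_derive x 1 (fun y : R => - y^-1) (- (- x^-2)) by exact: is_deriveN.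
  have dE : is_derive x 1 (fun y : R => expR (- y^-1)) (expR (- x^-1) * (- (- x^-2))).
    by apply: (is_derive1_comp (f := expR)).
  have dP : is_derive x 1 (fun y : R => P.[y^-1]) (P^`().[x^-1] * (- x^-2)).
    by apply: (is_derive1_comp (f := horner P)).
  have d : is_derive x 1 (fun y : R => P.[y^-1] * expR (- y^-1))
    (P.[x^-1] * (expR (- x^-1) * (- (- x^-2))) + expR (- x^-1) * (P^`().[x^-1] * (- x^-2))).
    exact: is_deriveM.
  apply: near_eq_is_derive d.
  near=> y; rewrite /flat ifT//.
  by near: y; exact: lt_nbhsr.
- have -> : flat ('X^2 * (P - P^`())) 0 = 0 by rewrite /flat ltxx.
  (* Two extra powers of 1/h are bounded: one is spent on the difference quotient, the other leaves
     a factor h that tends to 0. *)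
  have [C HC] := expRN_poly_bounded (P * 'X^2).
  have cv : h^-1 *: (flat P (h *: 1 + 0) - flat P 0) @[h --> 0^'] --> (0 : R).
    apply/cvgrPdist_le => e e0; near=> h.
    rewrite sub0r normrN /GRing.scale/= mulr1 addr0 {2}/flat ltxx subr0 /flat.
    case: ifPn => [h0|_]; last by rewrite mulr0 normr0 ltW.
    have {}HC := HC h^-1 _.
    have hV : 0 <= h^-1 by rewrite invr_ge0 ltW.
    have : `|P.[h^-1]| * expR (- h^-1) <= C * h ^+ 2.
      rewrite -ler_pdivrMr ?exprn_gt0//; apply: le_trans (HC hV).
      rewrite hornerM hornerXn normrM (ger0_norm (exprn_ge0 _ hV)) exprVn.
      by rewrite mulrAC.
    rewrite !normrM (ger0_norm (expR_ge0 _)) (ger0_norm hV) ler_pdivrMl// => H.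
    apply: (le_trans H).
    rewrite expr2 mulrA mulrC ler_wpM2l ?(ltW h0)//.
    apply: (@le_trans _ _ ((`|C| + 1) * `|h|)).
      by rewrite (gtr0_norm h0) ler_wpM2r ?(ltW h0)// (le_trans (ler_norm _))// ltW// ltrDl.
    rewrite mulrC -ler_pdivlMr ?ltr_wpDl//.
    by near: h; apply: dnbhs0_le; rewrite divr_gt0// ltr_wpDl.
  apply: DeriveDef; last exact/cvg_lim.
  by apply/cvg_ex; exists 0.
Unshelve. all: by end_near. Qed.

Lemma smooth_flat P : smooth (flat P).
Proof.
apply: (smooth_coind (S := [set f | exists Q, f = flat Q])); last by exists P.
move=> _ [Q ->]; split; first by move=> x; have [] := is_derive_flat Q x.
exists ('X^2 * (Q - Q^`())); apply/funext => x.
exact/is_derive1E/is_derive_flat.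
Qed.

End smooth.

(** * Primitives and integration by parts *)

Section primitive.
Context {R : realType}.
Local Notation mu := (@lebesgue_measure R).
Local Notation integ D f := (mu.-integrable D (EFin \o f)).
Implicit Types (f g : R -> R) (D : set (measurableTypeR R)).

Lemma integral_EFinZl D f (k : R) : measurable D -> integ D f ->
  (\int[mu]_(x in D) (k%:E * (f x)%:E))%E =
  (k * fine (\int[mu]_(x in D) (f x)%:E))%:E.
Proof.
move=> mD fi; rewrite integralZl// EFinM fineK//.
exact: integrable_fin_num.
Qed.

(** Both sides are iterated integrals of f(x) g(y) over the triangle y <= x; integrability on the
    plane comes from the bound |f(x)| |g(y)|. *)
Lemma fubini_triangle f g : integ setT f -> integ setT g ->
  \int[mu]_x (f x * \int[mu]_(y in `]-oo, x]) g y) =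
  \int[mu]_y (g y * \int[mu]_(x in `[y, +oo[) f x).
Proof.
move=> fi gi.
pose T := measurableTypeR R.
have mf : measurable_fun [set: T] f by apply/measurable_EFinP; exact: measurable_int fi.
have mg : measurable_fun [set: T] g by apply/measurable_EFinP; exact: measurable_int gi.
pose h (z : T * T) := if z.2 <= z.1 then f z.1 * g z.2 else 0.
have mh : measurable_fun setT h.
  apply: measurable_fun_ifT => //.
  - by apply: measurable_fun_ler.
  - by apply: measurable_funM; apply: measurableT_comp.
have hi : (mu \x mu)%E.-integrable setT (EFin \o h).
  apply/integrable12ltyP; first exact/measurable_EFinP.
  have gI : (\int[mu]_y `|(g y)%:E| < +oo)%E by case/integrableP : gi.
  have fI : (\int[mu]_y `|(f y)%:E| < +oo)%E by case/integrableP : fi.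
  have gE : (\int[mu]_y `|(g y)%:E|)%E = (\int[mu]_y `|g y|)%:E.
    by rewrite /Rintegral fineK// ge0_fin_numE// integral_ge0.
  apply: (@le_lt_trans _ _ (\int[mu]_x ((\int[mu]_y `|g y|)%:E * `|(f x)%:E|))%E).
    apply: ge0_le_integral => //.
    - by move=> x _; apply: integral_ge0.
    - apply: (@measurable_fun_fubini_tonelli_F _ _ T T R mu (fun z => `|(h z)%:E|)%E) => //.
      by apply: measurableT_comp => //; exact/measurable_EFinP.
    - apply: emeasurable_funM => //.
      by do 2 apply: measurableT_comp => //.
    - move=> x _; rewrite muleC -gE -ge0_integralZl//.
      + apply: ge0_le_integral => //.
        * apply: measurableT_comp => //; apply/measurable_EFinP.
          exact: (measurableT_comp mh (@pair1_measurable _ _ T T x)).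
        * apply: emeasurable_funM => //.
          by do 2 apply: measurableT_comp => //.
        * move=> y _; rewrite -EFinM lee_fin /h/=.
          by case: ifPn => _; rewrite ?normrM// normr0 mulr_ge0.
      + by do 2 apply: measurableT_comp => //.
  rewrite ge0_integralZl ?lte_mul_pinfty ?lee_fin ?Rintegral_ge0//.
  by do 2 apply: measurableT_comp => //.
have {hi mh} H := Fubini hi.
rewrite /Rintegral; congr fine.
transitivity (\int[mu]_x \int[mu]_y (h (x, y))%:E)%E.
  apply: eq_integral => x _; rewrite -integral_EFinZl; last 2 first.
  - exact: measurable_itv.
  - by apply: integrableS gi => //; exact: measurable_itv.
  rewrite integral_mkcond; apply: eq_integral => y _; rewrite patchE /h/=.
  rewrite (_ : (y \in `]-oo, x]%classic) = (y <= x)); last first.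
    by rewrite mem_setE in_itv.
  by case: ifP.
rewrite H; apply: eq_integral => x _; rewrite -integral_EFinZl; last 2 first.
- exact: measurable_itv.
- by apply: integrableS fi => //; exact: measurable_itv.
rewrite [RHS]integral_mkcond; apply: eq_integral => y _; rewrite patchE /h/=.
rewrite (_ : (y \in `[x, +oo[%classic) = (x <= y)); last first.
  by rewrite mem_setE in_itv/= andbT.
by case: ifP => // _; rewrite mulrC.
Qed.

(** For x < a the interval is empty and the value is 0, so that the primitive of a bump is a test
    function on the whole line. *)
Definition prim (a : R) g (x : R) : R := \int[mu]_(t in `[a, x]) g t.

Lemma integrable_patch D f : measurable D -> integ D f -> integ setT (f \_ D).
Proof.
move=> mD fi; have := (@integrable_mkcond _ _ R mu D (EFin \o f) mD).1 fi.
by rewrite restrict_EFin.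
Qed.

Lemma integrable_itvS (a b x y : R) f : integ `[a, b] f -> a <= x -> y <= b ->
  integ `[x, y] f.
Proof.
move=> fi ax yb; apply: integrableS fi => //.
by apply: subset_itv; rewrite bnd_simp.
Qed.

Lemma primB (a b x y : R) f : integ `[a, b] f -> a <= x -> x <= y -> y <= b ->
  \int[mu]_(t in `[x, y]) f t = prim a f y - prim a f x.
Proof.
move=> fi ax xy yb.
rewrite /prim Rintegral_itvB ?bnd_simp//; last by apply: integrable_itvS fi _ _.
rewrite Rintegral_itv_obnd_cbnd//; apply: integrableS fi => //.
by apply: subset_itv; rewrite bnd_simp.
Qed.

Lemma integrable_contM (a b : R) f g : {within `[a, b], continuous f} ->
  integ `[a, b] g -> integ `[a, b] (fun x => f x * g x).
Proof.
move=> fc gi; have mD : measurable (`[a, b] : set (measurableTypeR R)).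
  exact: measurable_itv.
apply: (@integrableMr _ _ _ _ _ mD f (EFin \o g)) => //.
  exact: subspace_continuous_measurable_fun.
have /compact_bounded[M [_ HM]] := continuous_compact fc (@segment_compact R a b).
by exists M; split; rewrite ?num_real// => x Mx y Dy; apply: HM => //; exists y.
Qed.

Lemma prim_continuous (a b : R) f : a <= b -> integ `[a, b] f ->
  {within `[a, b], continuous prim a f}.
Proof. exact: parameterized_integral_continuous. Qed.

(** The functions are merely integrable, so Fubini on the triangle replaces the differentiation of a
    product: exchanging the order turns the first integral into that of g(x) times the integral of f
    over [x, b]. *)
Lemma prim_parts (a b : R) f g : a <= b -> integ `[a, b] f -> integ `[a, b] g ->
  \int[mu]_(x in `[a, b]) (f x * prim a g x) +
  \int[mu]_(x in `[a, b]) (prim a f x * g x) = prim a f b * prim a g b.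
Proof.
move=> ab fi gi; pose D := `[a, b]%classic : set (measurableTypeR R).
have mD : measurable D by exact: measurable_itv.
have := fubini_triangle (integrable_patch mD fi) (integrable_patch mD gi).
have -> : \int[mu]_x ((f \_ D) x * \int[mu]_(y in `]-oo, x]) (g \_ D) y) =
    \int[mu]_(x in D) (f x * prim a g x).
  rewrite [RHS]Rintegral_mkcond; apply: eq_Rintegral => x _; rewrite !patchE.
  case: ifPn => [/[!inE]/= + |_]; last by rewrite mul0r.
  rewrite /D/= in_itv/= => /andP[ax xb]; congr (_ * _).
  rewrite -Rintegral_mkcondr; congr (Rintegral _ _ _).
  apply/seteqP; split => y; rewrite /D/= !in_itv/=.
    by move=> [yx /andP[ay yb]]; rewrite ay.
  by move=> /andP[ay yx]; rewrite yx ay (le_trans yx xb).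
have -> : \int[mu]_x ((g \_ D) x * \int[mu]_(y in `[x, +oo[) (f \_ D) y) =
    \int[mu]_(x in D) (g x * (prim a f b - prim a f x)).
  rewrite [RHS]Rintegral_mkcond; apply: eq_Rintegral => x _; rewrite !patchE.
  case: ifPn => [/[!inE]/= + |_]; last by rewrite mul0r.
  rewrite /D/= in_itv/= => /andP[ax xb]; congr (_ * _).
  rewrite -(primB fi)// -Rintegral_mkcondr; congr (Rintegral _ _ _).
  apply/seteqP; split => y; rewrite /D/= !in_itv/= andbT.
    by move=> [xy /andP[ay yb]]; rewrite xy.
  by move=> /andP[xy yb]; rewrite xy yb (le_trans ax xy).
have bp h k : integ D h -> integ D k -> integ D (fun x => prim a h x * k x).
  by move=> hi ki; apply: integrable_contM => //; exact: prim_continuous.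
rewrite -(_ : \int[mu]_(x in D) (prim a g x * f x) =
    \int[mu]_(x in D) (f x * prim a g x)); last first.
  by apply: eq_Rintegral => x _; rewrite mulrC.
have i1 : integ D (fun x => g x * (prim a f b - prim a f x)).
  have := integrableB mD (integrableZl mD (prim a f b) gi) (bp _ _ fi gi).
  by apply: eq_integrable => // x _; rewrite /= -EFinB; congr EFin; ring.
move=> ->; rewrite -RintegralD//; last exact: bp.
rewrite -[RHS]RintegralZl//; apply: eq_Rintegral => x _; ring.
Qed.

End primitive.

(** * The du Bois-Reymond lemma *)

Section test_functions.
Context {R : realType}.
Local Notation mu := (@lebesgue_measure R).
Local Notation integ D f := (mu.-integrable D (EFin \o f)).
Implicit Types (f g w : R -> R) (D : set (measurableTypeR R)).

Lemma measurable_itvR (i : interval R) :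
  measurable ([set` i] : set (measurableTypeR R)).
Proof. exact: measurable_itv. Qed.
Hint Resolve measurable_itvR : core.

(** By Lebesgue differentiation the primitive has derivative f at almost every point, and near an
    interior point it is constantly 0. *)
Lemma prim_eq0_ae (a b : R) f : integ `[a, b] f ->
  (forall x, x \in `]a, b[ -> prim a f x = 0) ->
  {ae mu, forall x, x \in `]a, b[ -> f x = 0}.
Proof.
move=> fi f0.
pose g := f \_ `[a, b].
have gi : integ setT g by exact: integrable_patch.
have := @FTC1 R g (BLeft a) _ (integrable_locally_restrict (measurable_itvR `[a, b]) fi).
have gy (y : R) : integ [set` Interval (BLeft a) (BRight y)] g.
  exact: integrableS gi.
move=> /(_ gy); apply: filterS; first exact: (ae_filter_ringOfSetsType mu).
move=> x H xab.
have /andP[ax xb] : a < x < b by rewrite in_itv/= in xab.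
have [] := H _; first by rewrite lte_fin.
have -> : g x = f x by rewrite /g patchE mem_set//= in_itv/= (ltW ax) (ltW xb).
move=> _ <-.
apply: is_derive1E.
apply: near_eq_is_derive (is_derive_cst (0 : R) x 1).
near=> y.
have yab : y \in `]a, b[ by near: y; apply: near_in_itvoo.
rewrite -(f0 _ yab) /prim; apply: eq_Rintegral => z.
rewrite inE/= in_itv/= => /andP[az zy].
rewrite /g patchE mem_set//= in_itv/= az/=.
by move: yab; rewrite in_itv/= => /andP[_ /ltW]; exact: le_trans.
Unshelve. all: by end_near. Qed.

(** The support is enclosed by explicit endpoints. They need not be ordered: when c > d the function
    is zero, which covers the plateaus whose two margins overlap. *)
Definition bump (a b : R) w := smooth w /\
  exists c d : R, [/\ a < c, d < b & forall x, w x != 0 -> c <= x <= d].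

Lemma bumpB (a b k : R) f g : bump a b f -> bump a b g ->
  bump a b (fun x => f x + k * g x).
Proof.
move=> [sf [c1 [d1 [ac1 db1 H1]]]] [sg [c2 [d2 [ac2 db2 H2]]]]; split.
  apply: smooth_alg_smooth; apply: SmoothAdd; first exact: SmoothBase.
  apply: (SmoothMul (f := cst k)); apply: SmoothBase; last exact: sg.
  exact: smooth_cst.
exists (Num.min c1 c2), (Num.max d1 d2); split.
- by rewrite lt_min ac1.
- by rewrite gt_max db1.
- move=> x; rewrite ge_min le_max.
  have [f0|/H1/andP[-> ->]//] := eqVneq (f x) 0.
  have [g0|/H2/andP[-> ->]//] := eqVneq (g x) 0; last by rewrite !orbT.
  by rewrite f0 g0 mulr0 addr0 eqxx.
Qed.

Lemma smooth_continuous f : smooth f -> continuous f.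
Proof.
by move=> sf x; apply: differentiable_continuous; exact/derivable1_diffP/smooth_derivable.
Qed.

Lemma continuous_integ (a b : R) f : continuous f -> integ `[a, b] f.
Proof.
move=> cf; apply: continuous_compact_integrable; first exact: segment_compact.
exact: continuous_subspaceT.
Qed.

(** Beyond d the primitive already equals the total integral, so zero mean is exactly what gives it
    compact support. *)
Lemma bump_prim (a b : R) w : a <= b -> bump a b w ->
  \int[mu]_(x in `[a, b]) w x = 0 ->
  test_function `]a, b[ (prim a w) /\ derive1 (prim a w) = w.
Proof.
move=> ab [sw [c [d [ac db wcd]]]] w0.
have wi y : integ `[a, y] w by exact/continuous_integ/smooth_continuous.
have outl x : x < c -> prim a w x = 0.
  move=> xc; rewrite /prim -[RHS](mul0r (fine (mu `[a, x]))) -Rintegral_cst//.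
  apply: eq_Rintegral => y; rewrite inE/= in_itv/= => /andP[_ yx].
  apply/eqP; apply: contraT => /wcd /andP[cy _].
  by have := le_lt_trans (le_trans cy yx) xc; rewrite ltxx.
have outr x : d < x -> prim a w x = 0.
  move=> dx; rewrite -w0 /prim Rintegral_mkcond [RHS]Rintegral_mkcond.
  apply: eq_Rintegral => y _; rewrite !patchE.
  have [->|/wcd /andP[cy yd]] := eqVneq (w y) 0; first by do 2 case: ifP.
  have ay : a <= y by rewrite (le_trans (ltW ac)).
  rewrite !mem_set//= in_itv/= ay/= (le_trans yd) ?ltW//.
have dp (x : R) : is_derive x 1 (prim a w) (w x).
  (* The fundamental theorem is used at points x > a; the points left of c, among them all x <= a,
     are those near which the primitive is constantly 0. *)
  have [xc|cx] := ltP x c.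
    have -> : w x = 0.
      by apply/eqP; apply: contraT => /wcd /andP[]; rewrite leNgt xc.
    apply: near_eq_is_derive (is_derive_cst (0 : R) x 1).
    by near=> y; rewrite outl//; near: y; exact: lt_nbhsl.
  have wx : {for x, continuous w} by exact: smooth_continuous.
  have x1 : x < x + 1 by rewrite ltrDl.
  have [dw <-] := continuous_FTC1_closed x1 (wi _) (lt_le_trans ac cx) wx.
  by apply: is_derive1_derive1.
have dE : derive1 (prim a w) = w by apply/funext => x; exact: is_derive1E.
have supp : [set x | prim a w x != 0] `<=` `[c, d].
  move=> x /= px; rewrite in_itv/=; apply/andP; split.
    by rewrite leNgt; apply: contra px => /outl ->.
  by rewrite leNgt; apply: contra px => /outr ->.
have csupp : closure [set x | prim a w x != 0] `<=` `[c, d].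
  have /closure_id -> : closed `[c, d]%classic by exact: itv_closed.
  exact: closureS.
split; last exact: dE.
split.
- case=> [|n] x; first by have [] := dp x.
  by rewrite derive1Sn dE.
- apply: subclosed_compact csupp; first exact: closed_closure.
  exact: segment_compact.
- apply: subset_trans csupp _; apply: subset_itv; rewrite bnd_simp//.
Unshelve. all: by end_near. Qed.

(* A bump supported in [x + 1/(n+1), y - 1/(n+1)] which tends pointwise to the
   indicator of ]x, y[. *)
Definition plateau (x y : R) (n : nat) (t : R) : R :=
  flat 1 (n.+1%:R * (t - x) - 1) * flat 1 (n.+1%:R * (y - t) - 1).

Lemma flat1_ge0 (t : R) : 0 <= flat 1 t.
Proof. by rewrite /flat; case: ifP => // _; rewrite hornerC mul1r expR_ge0. Qed.

Lemma flat1_le1 (t : R) : flat 1 t <= 1.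
Proof.
rewrite /flat; case: ifP => // t0.
by rewrite hornerC mul1r -(expR0 R) ler_expR oppr_le0 invr_ge0 ltW.
Qed.

Lemma flat1_cvg (d : R) : 0 < d -> flat 1 (n.+1%:R * d - 1) @[n --> \oo] --> (1 : R).
Proof.
move=> d0; apply/cvgrPdist_le => e e0; near=> n.
have : e^-1 < n.+1%:R * d - 1.
  rewrite ltrBrDr -ltr_pdivrMr//; near: n.
  have := nbhs_infty_gtr ((e^-1 + 1) / d).
  by apply: filterS => n /lt_trans; apply; rewrite ltr_nat.
set y := _ - 1 => ey.
have y0 : 0 < y by apply: lt_trans ey; rewrite invr_gt0.
rewrite ger0_norm ?subr_ge0 ?flat1_le1// /flat y0 hornerC mul1r.
have := expR_ge1Dx (- y^-1) => H.
have : y^-1 <= e by rewrite -[e]invrK lef_pV2 ?posrE ?invr_gt0// ltW.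
lra.
Unshelve. all: by end_near. Qed.

Lemma bump_plateau (a b x y : R) n : a <= x -> y <= b -> bump a b (plateau x y n).
Proof.
move=> ax yb; split.
  have -> : plateau x y n = fun t => flat 1 (n.+1%:R * t + (- n.+1%:R * x - 1)) *
      flat 1 (- n.+1%:R * t + (n.+1%:R * y - 1)).
    by apply/funext => t; rewrite /plateau; congr (flat _ _ * flat _ _); ring.
  apply: smooth_alg_smooth; apply: SmoothMul; apply: SmoothAff; apply: SmoothBase;
  exact: smooth_flat.
have [k k0 kE] : exists2 k : R, 0 < k & n.+1%:R^-1 = k.
  by exists n.+1%:R^-1; rewrite ?invr_gt0.
exists (x + k), (y - k); split; [lra|lra|move=> t; rewrite /plateau /flat].
case: ifPn; last by rewrite mul0r eqxx.
case: ifPn; last by rewrite mulr0 eqxx.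
rewrite !subr_gt0 -!ltr_pdivrMl// !mulr1 kE => h1 h2 _.
apply/andP; split; lra.
Qed.

Lemma plateau_cvg (x y t : R) :
  plateau x y n t @[n --> \oo] --> (\1_(`]x, y[) t : R).
Proof.
rewrite indicE; have [] := boolP (t \in _).
  rewrite inE/= in_itv/= => /andP[xt ty].
  rewrite -[1%:R]mulr1; apply: cvgM; apply: flat1_cvg; by rewrite subr_gt0.
move=> tN; rewrite (_ : (fun n => _) = fun=> 0); first exact: cvg_cst.
apply/funext => n; rewrite /plateau /flat.
have [xt|xt] := leP t x.
  rewrite ltNge subr_le0 (_ : _ <= 1) ?mul0r//.
  by rewrite (@le_trans _ _ 0)// mulr_ge0_le0// subr_le0.
have [ty|ty] := leP y t.
  rewrite [X in _ * (if X then _ else _)]ltNge subr_le0 (_ : _ <= 1) ?mulr0//.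
  by rewrite (@le_trans _ _ 0)// mulr_ge0_le0// subr_le0.
by move: tN; rewrite notin_setE/= in_itv/= xt ty.
Qed.

(** Dominated convergence with bound |f|, the plateaus having values in [0, 1]; the limit is over
    ]x, y[, which differs from [x, y] by a null set. *)
Lemma cvg_int_plateau (a b x y : R) f : integ `[a, b] f -> a <= x -> x <= y -> y <= b ->
  \int[mu]_(t in `[a, b]) (f t * plateau x y n t) @[n --> \oo] -->
  \int[mu]_(t in `[x, y]) f t.
Proof.
move=> fi ax xy yb.
have mD := measurable_itvR `[a, b].
have mf : measurable_fun (`[a, b] : set (measurableTypeR R)) f.
  by apply/measurable_EFinP; exact: measurable_int fi.
pose g t := f t * \1_(`]x, y[) t.
have mw n : measurable_fun (`[a, b] : set (measurableTypeR R)) (plateau x y n).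
  apply: measurable_funTS; apply: continuous_measurable_fun.
  by apply: smooth_continuous; have [] := @bump_plateau a b x y n ax yb.
have gE : \int[mu]_(t in `[x, y]) f t = \int[mu]_(t in `[a, b]) g t.
  rewrite /Rintegral integral_itv_bndoo; last first.
    apply: measurable_funS (measurable_int _ fi) => //.
    by apply: subset_itv; rewrite bnd_simp.
  congr fine; rewrite [LHS]integral_mkcond [RHS]integral_mkcond.
  apply: eq_integral => t _; rewrite !patchE /g indicE.
  have [txy|txy] := boolP (t \in `]x, y[%classic).
    rewrite mulr1 mem_set//=; apply: subset_itv (set_mem txy); rewrite bnd_simp//.
  by rewrite mulr0; case: ifP.
rewrite gE.
have [] := @dominated_convergence _ _ R mu _ mD (fun n => EFin \o (fun t => f t * plateau x y n t))
  (EFin \o g) (abse \o (EFin \o f)).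
- by move=> n; apply/measurable_EFinP; exact: measurable_funM.
- apply/measurable_EFinP; apply: measurable_funM => //.
- apply: aeW => t _ /=; apply: cvg_EFin; first exact: nearW.
  by apply: cvgMr; exact: plateau_cvg.
- exact: integrable_abse.
- apply: aeW => t n _ /=; rewrite lee_fin normrM ler_piMr//.
  rewrite ger0_norm ?mulr_ge0 ?flat1_ge0//.
  by rewrite mulr_ile1 ?flat1_ge0 ?flat1_le1.
move=> gi _ H; have gfin := integrable_fin_num mD gi.
by apply: fine_cvg; rewrite /Rintegral fineK.
Qed.

(* The constant is the limit of the quotients int f w / int w over bumps w; any
   two bumps have the same quotient since w - (int w / int v) v has zero mean,
   hence is the derivative of a test function. *)
Lemma du_bois_reymond (a b : R) f : a < b -> integ `[a, b] f ->
  (forall phi, test_function `]a, b[ phi ->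
     \int[mu]_(x in `[a, b]) (f x * derive1 phi x) = 0) ->
  exists c : R, {ae mu, forall x, x \in `]a, b[ -> f x = c}.
Proof.
move=> ab fi f0; have mD := measurable_itvR `[a, b].
have oi : integ `[a, b] (cst 1).
  by apply: continuous_integ => x; exact: cvg_cst.
have bi w : bump a b w -> integ `[a, b] w.
  by case=> sw _; exact/continuous_integ/smooth_continuous.
have fbi w : bump a b w -> integ `[a, b] (fun x => f x * w x).
  move=> [sw _].
  have := @integrable_contM R a b w f _ fi.
  rewrite (_ : (fun x => w x * f x) = fun x => f x * w x); last first.
    by apply/funext => x; rewrite mulrC.
  by apply; apply: continuous_subspaceT; exact: smooth_continuous.
pose I w := \int[mu]_(x in `[a, b]) w x.
(* The integrals of the plateaus of ]a, b[ tend to b - a > 0, so they cannot all vanish. *)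
have [v bv Iv] : exists2 v, bump a b v & I v != 0.
  apply: contrapT => H.
  have I0 n : I (plateau a b n) = 0.
    apply: contrapT => /eqP In; apply: H; exists (plateau a b n) => //.
    exact: bump_plateau.
  have := cvg_int_plateau oi (lexx a) (ltW ab) (lexx b).
  rewrite (_ : (fun n => _) = fun=> 0); last first.
    apply/funext => n; rewrite -(I0 n); apply: eq_Rintegral => x _.
    by rewrite mul1r.
  have -> : \int[mu]_(t in `[a, b]) cst 1 t = b - a.
    rewrite [LHS](Rintegral_cst mu mD 1) mul1r.
    by have := lebesgue_measure_itv `[a, b] => /= ->; rewrite lte_fin ab.
  move=> h; have : b - a = 0 by apply: (cvg_unique _ h) => //; exact: cvg_cst.
  by move/eqP; rewrite subr_eq0 gt_eqF.
pose c := I (fun x => f x * v x) / I v.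
have fw w : bump a b w -> I (fun x => f x * w x) = c * I w.
  move=> bw; pose k := - (I w / I v).
  have bB : bump a b (fun x => w x + k * v x) by exact: bumpB.
  have kvi : integ `[a, b] (fun x => k * v x).
    by have := integrableZl mD k (bi _ bv).
  have kfvi : integ `[a, b] (fun x => k * (f x * v x)).
    by have := integrableZl mD k (fbi _ bv).
  have B0 : \int[mu]_(x in `[a, b]) (w x + k * v x) = 0.
    rewrite RintegralD//; last exact: bi.
    rewrite RintegralZl//; last exact: bi.
    by rewrite -/(I w) -/(I v) /k mulNr divfK// subrr.
  have [tp dp] := bump_prim (ltW ab) bB B0.
  have := f0 _ tp; rewrite dp.
  rewrite (_ : \int[mu]_(x in `[a, b]) _ =
      \int[mu]_(x in `[a, b]) (f x * w x + k * (f x * v x))); last first.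
    by apply: eq_Rintegral => x _; ring.
  rewrite RintegralD//; last exact: fbi.
  rewrite RintegralZl//; last exact: fbi.
  rewrite -/(I (fun x => f x * w x)) -/(I (fun x => f x * v x)) /k /c.
  by move=> /eqP; rewrite addr_eq0 => /eqP ->; rewrite mulNr opprK [LHS]mulrAC -[LHS]mulrA [LHS]mulrC.
exists c.
have ci : integ `[a, b] (fun x => c).
  by apply: continuous_integ => x; exact: cvg_cst.
have fci : integ `[a, b] (fun x => f x - c).
  by have := integrableB mD fi ci.
have := prim_eq0_ae fci; rewrite /prim => H.
suff : {ae mu, forall x, x \in `]a, b[ -> f x - c = 0}.
  apply: filterS; first exact: (ae_filter_ringOfSetsType mu).
  by move=> x Hx /Hx /eqP; rewrite subr_eq0 => /eqP.
apply: H => x; rewrite in_itv/= => /andP[ax xb].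
have xi g : integ `[a, b] g -> integ `[a, x] g.
  by move=> gi; apply: integrable_itvS gi _ _ => //; exact: ltW.
rewrite RintegralB//; [|exact: xi|exact: xi].
apply/eqP; rewrite subr_eq0; apply/eqP.
(* The identity [fw] passes to the limit along the plateaus of ]a, x[, so f and the constant c have
   the same integral over [a, x]. *)
have h1 := cvg_int_plateau fi (lexx a) (ltW ax) (ltW xb).
have h2 := cvg_int_plateau ci (lexx a) (ltW ax) (ltW xb).
apply: cvg_unique h1 _ => //.
rewrite (_ : (fun n => _) = (fun n => \int[mu]_(t in `[a, b]) (c * plateau a x n t))) //.
apply/funext => n; have bp : bump a b (plateau a x n).
  by apply: bump_plateau => //; exact: ltW.
rewrite [RHS]RintegralZl//; last exact: bi.
exact: fw bp.
Qed.

End test_functions.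

(** * Lebesgue spaces on an interval *)

Lemma ae_imply d (T : measurableType d) (R : realType)
    (m : {measure set T -> \bar R}) (P Q : T -> Prop) :
  (forall x, P x -> Q x) -> {ae m, forall x, P x} -> {ae m, forall x, Q x}.
Proof.
by move=> PQ; exact: filterS.
Qed.

Lemma ae_imply2 d (T : measurableType d) (R : realType)
    (m : {measure set T -> \bar R}) (P1 P2 Q : T -> Prop) :
  (forall x, P1 x -> P2 x -> Q x) ->
  {ae m, forall x, P1 x} -> {ae m, forall x, P2 x} -> {ae m, forall x, Q x}.
Proof.
by move=> PQ; exact: filterS2.
Qed.

Section interval_domain.
Context {R : realType} (Omega : set R) (oOmega : open Omega) (a b : R).
Hypotheses (ab : a < b) (OE : Omega = `]a, b[%classic).
Local Notation mu := (@lebesgue_measure R).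
Local Notation integ D f := (mu.-integrable D (EFin \o f)).
Local Notation T := (measurableTypeR R).
Local Notation nu := (leb oOmega).
Local Notation mfun f := (measurable_fun [set: T] (f : T -> T)).
Implicit Types (f g : R -> R).

Lemma measurable_Omega : measurable (Omega : set T).
Proof. by rewrite OE; exact: measurable_itv. Qed.

Lemma ae_leb (P : R -> Prop) :
  {ae nu, forall x, P x} <-> {ae mu, forall x, Omega x -> P x}.
Proof.
have mO := measurable_Omega.
split=> -[A [mA A0 NA]].
  exists (A `&` Omega); split => //; first exact: measurableI.
  by move=> x /= /not_implyP[Ox nP]; split => //; exact: NA.
exists (A `|` ~` Omega); split.
- by apply: measurableU => //; exact: measurableC.
- rewrite /= /mrestr setIUl setICl setU0.
  apply/eqP; rewrite eq_le measure_ge0 andbT -A0.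
  by apply: le_measure; rewrite ?inE//; exact: measurableI.
- move=> x /= nP; have [Ox|nO] := pselect (Omega x); last by right.
  by left; apply: NA => /=; apply/not_implyP.
Qed.

(** The closed interval is where primitives and continuous functions are handled; the two endpoints
    are null. *)
Lemma leb_integralE (f : T -> \bar R) : measurable_fun setT f ->
  (\int[nu]_x f x = \int[mu]_(x in `[a, b]) f x)%E.
Proof.
move=> mf; have mO := measurable_Omega.
transitivity (\int[nu]_(x in Omega) f x)%E.
  rewrite [RHS]integral_mkcond; apply: ae_eq_integral => //.
    by apply/(measurable_restrictT _ _).1 => //; exact: measurable_funTS.
  apply/ae_leb; apply: aeW => x Ox _.
  by rewrite patchE mem_set.
rewrite (@eq_measure_integral _ _ _ _ mu); last first.
  by move=> A mA AO; rewrite /= /mrestr setIidl.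
rewrite OE integral_itv_bndoo//.
exact: measurable_funTS.
Qed.

Lemma leb_RintegralE f : mfun f ->
  \int[nu]_x f x = \int[mu]_(x in `[a, b]) f x.
Proof.
by move=> mf; rewrite /Rintegral leb_integralE//; exact/measurable_EFinP.
Qed.

Lemma leb_integrableE f : mfun f ->
  nu.-integrable setT (EFin \o f) <-> integ `[a, b] f.
Proof.
move=> mf; have mf' : measurable_fun setT (EFin \o f) by exact/measurable_EFinP.
have E : (\int[nu]_x `|(EFin \o f) x| = \int[mu]_(x in `[a, b]) `|(EFin \o f) x|)%E.
  by rewrite leb_integralE//; apply: measurableT_comp.
split=> /integrableP[_ h]; apply/integrableP; split => //.
- exact: measurable_funTS.
- by rewrite -E.
- by rewrite E.
Qed.

Lemma leb_setT : nu setT = (b - a)%:E.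
Proof.
by rewrite /= /mrestr setTI OE lebesgue_measure_itv/= lte_fin ab -EFinB.
Qed.

Section Lp.
Context (p : R) (p1 : (1 <= p%:E)%E).
Local Notation Lp := (Leb oOmega p1).
Local Notation inL f := ((f : R -> R) \in Lfun nu p%:E).

Lemma mem_LfunP f : inL f <-> mfun f /\ finite_norm nu p%:E f.
Proof.
rewrite !inE; split.
  by move=> /andP[]; rewrite !inE.
by move=> [mf ff]; apply/andP; rewrite !inE.
Qed.

Lemma Leb_Lfun (F : Lp) : inL F.
Proof.
apply/mem_LfunP; split; first exact: measurable_funPT.
by case: F => F [[]].
Qed.

Lemma Leb_measurable (F : Lp) : mfun F.
Proof. by have /mem_LfunP[] := Leb_Lfun F. Qed.

Lemma ae_eq_Lnorm f g : mfun f -> mfun g -> {ae nu, forall x, f x = g x} ->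
  ('N[nu]_p%:E[EFin \o f] = 'N[nu]_p%:E[EFin \o g])%E.
Proof.
move=> mf mg fg; rewrite unlock /=.
apply: (congr1 (fun z => z `^ p^-1)%E).
have m h : mfun h -> measurable_fun [set: T] (fun x => `|(EFin \o h) x| `^ p)%E.
  move=> mh; apply/measurable_EFinP.
  apply: (@measurableT_comp _ _ _ _ _ _ (@powR R ^~ p)) => //.
  exact: measurableT_comp.
apply: ae_eq_integral; [by []|exact: m|exact: m|].
by apply: ae_imply fg => x fgx _; rewrite /= fgx.
Qed.

Lemma ae_eq_Lnrm f g : mfun f -> mfun g -> {ae nu, forall x, f x = g x} ->
  Lnrm oOmega p f = Lnrm oOmega p g.
Proof. by move=> mf mg fg; rewrite /Lnrm (ae_eq_Lnorm mf mg fg). Qed.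

(** An element is a class read through its canonical representative, together with a proof of finite
    norm. Representatives equal almost everywhere therefore come from one class; this makes
    uniqueness of u and p a genuine equality. *)
Lemma Leb_eqP (F G : Lp) : {ae nu, forall x, F x = G x} -> F = G.
Proof.
case: F G => [F [[cF]]] [G [[cG]]] FG.
have E : F = G.
  have /ae_eqP/eqP : F = G %[ae nu] by apply: ae_imply FG => x h _; exact: h.
  by rewrite !reprK.
by subst G; rewrite (Prop_irrelevance cF cG).
Qed.

(** The class of f has its own representative, so agreement with f holds only almost everywhere. *)
Lemma Lfun_Leb f : inL f -> exists F : Lp, {ae nu, forall x, F x = f x}.
Proof.
move=> /mem_LfunP[mf nf].
pose g : {mfun T >-> T} := HB.pack f (isMeasurableFun.Build _ _ T T f mf).
pose G : {mfun_ nu, T >-> T} := \pi_({mfun_ nu, T >-> T})%qT g.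
have GE : {ae nu, forall x, G x = f x}.
  have /eqquotP/asboolP : repr G = g %[mod {mfun_ nu, T >-> T}]%qT.
    by rewrite reprK.
  by apply: ae_imply => x; apply.
have nG : finite_norm nu p%:E G.
  by rewrite /finite_norm (ae_eq_Lnorm _ mf GE)//; exact: measurable_funPT.
by exists (LebesgueSpace.Pack (LebesgueSpace.Class
  (isFinLebesgue.Axioms_ _ _ _ _ p1 _ nG))).
Qed.

Lemma Lfun_add f g : inL f -> inL g -> inL (fun x => f x + g x).
Proof. exact: rpredD. Qed.

Lemma Lfun_scalel c f : inL f -> inL (fun x => c * f x).
Proof.
move=> fL; rewrite (_ : (fun x => _) = (c \o* f)).
  by apply: Lfun_scale fL; rewrite -lee_fin.
by apply/funext => x; rewrite /= mulrC.
Qed.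

Lemma Lfun_bounded f (M : R) : mfun f -> (forall x, `|f x| <= M) -> inL f.
Proof.
move=> mf fM; apply/mem_LfunP; split => //.
rewrite /finite_norm unlock poweR_lty//.
have p0 : 0 < p by rewrite (lt_le_trans ltr01).
apply: (@le_lt_trans _ _ (\int[nu]_x (M `^ p)%:E)%E).
  apply: ge0_le_integral => //.
  - by move=> x _; rewrite lee_fin powR_ge0.
  - apply/measurable_EFinP.
    apply: (@measurableT_comp _ _ _ _ _ _ (@powR R ^~ p)) => //.
    exact: measurableT_comp.
  - move=> x _; rewrite /= lee_fin ge0_ler_powR ?nnegrE ?(ltW p0)//.
    by rewrite (le_trans _ (fM x)).
by rewrite integral_cst// leb_setT ltry.
Qed.

(** Continuity within [a, b] says nothing outside, not even measurability; hence the extension by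
    zero. *)
Lemma Lfun_continuous f : {within `[a, b], continuous f} -> inL (f \_ `[a, b]).
Proof.
move=> fc; have mD := measurable_itvR `[a, b].
have /compact_bounded[M [_ HM]] := continuous_compact fc (@segment_compact R a b).
apply: (@Lfun_bounded _ (`|M| + 1)).
  apply/(measurable_restrictT _ _).1 => //.
  exact: subspace_continuous_measurable_fun.
move=> x; rewrite patchE; case: ifPn => [/[!inE] xab|_]; last first.
  by rewrite normr0 addr_ge0.
apply: HM; last by exists x.
by rewrite (le_lt_trans (ler_norm M))// ltrDl.
Qed.

Lemma continuous_Leb f : {within `[a, b], continuous f} ->
  exists F : Lp, {ae nu, forall x, F x = f x}.
Proof.
move=> fc; have [F FE] := Lfun_Leb (Lfun_continuous fc).
exists F; apply/ae_leb; move: FE => /ae_leb.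
apply: ae_imply => x h Ox; rewrite h// patchE mem_set//.
by move: Ox; rewrite OE; apply: subset_itv; rewrite bnd_simp.
Qed.

End Lp.

(** Hölder's inequality against the constant 1; K is the norm of 1 in the conjugate exponent, finite
    because Omega has finite length. *)
Lemma Lfun_Rintegral_le (p : R) (p1 : 1 < p) : exists2 K : R, 0 < K &
  forall f, f \in Lfun nu p%:E -> nu.-integrable setT (EFin \o f) /\
    \int[nu]_x `|f x| <= K * Lnrm oOmega p f.
Proof.
pose K := fine ('N[nu]_(conj_exp p)%:E[cst 1%E])%E.
have p0 : 0 < p by lra.
have cp0 : 0 < conj_exp p by rewrite divr_gt0// subr_gt0.
have KE : ('N[nu]_(conj_exp p)%:E[EFin \o cst 1%R] = K%:E)%E.
  rewrite /K fineK; first by [].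
  by rewrite Lnorm_cst1 leb_setT fin_num_poweR.
have K0 : 0 < K.
  rewrite /K Lnorm_cst1 leb_setT /= powR_gt0// subr_gt0//.
exists K => // f /(mem_LfunP)[mf nf].
have NE : ('N[nu]_p%:E[EFin \o f])%E = (Lnrm oOmega p f)%:E.
  by rewrite /Lnrm fineK// ge0_fin_numE// Lnorm_ge0.
have pq : p^-1 + (conj_exp p)^-1 = 1 by rewrite /conj_exp; field; lra.
have m1 : mfun (cst 1 : R -> R) by exact: measurable_cst.
have H := @hoelder _ _ _ nu f (cst 1) p (conj_exp p) mf m1 p0 cp0 pq.
rewrite KE NE -EFinM Lnorm1 in H.
have E : (\int[nu]_x `|(EFin \o (f \* cst 1)%R) x| = \int[nu]_x `|(f x)%:E|)%E.
  by apply: eq_integral => x _; rewrite /= mulr1.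
rewrite E in H; split.
  apply/integrableP; split; first exact/measurable_EFinP.
  by apply: le_lt_trans H _; rewrite ltry.
rewrite -lee_fin /Rintegral fineK; first by rewrite mulrC.
rewrite ge0_fin_numE; last exact: integral_ge0.
by apply: le_lt_trans H _; rewrite ltry.
Qed.

End interval_domain.

(** * Sobolev functions on an interval *)

Section sobolev_interval.
Context {R : realType} (Omega : set R) (oOmega : open Omega) (a b : R).
Hypotheses (ab : a < b) (OE : Omega = `]a, b[%classic).
Local Notation mu := (@lebesgue_measure R).
Local Notation integ D f := (mu.-integrable D (EFin \o f)).
Local Notation T := (measurableTypeR R).
Local Notation nu := (leb oOmega).
Local Notation mfun f := (measurable_fun [set: T] (f : T -> T)).
Context (p : R) (p1 : (1 <= p%:E)%E).
Local Notation Lp := (Leb oOmega p1).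
Local Notation W := (W1 oOmega p1).
Implicit Types (f g : R -> R).

Lemma Lfun_leb_integrable f : f \in Lfun nu p%:E -> nu.-integrable setT (EFin \o f).
Proof.
move=> fL; apply/Lfun1_integrable; apply: (@Lfun_subset _ _ _ nu 1 p%:E _ p1) fL => //.
by rewrite (leb_setT oOmega ab OE).
Qed.

Lemma Leb_integrable (F : Lp) : nu.-integrable setT (EFin \o (F : R -> R)).
Proof. by apply: Lfun_leb_integrable; exact: Leb_Lfun. Qed.

Lemma Leb_integ (F : Lp) : integ `[a, b] (F : R -> R).
Proof.
by apply/(leb_integrableE oOmega OE); [exact: Leb_measurable|exact: Leb_integrable].
Qed.

Lemma smooth_mfun f : smooth f -> mfun f.
Proof.
by move=> sf; apply: continuous_measurable_fun; exact: smooth_continuous.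
Qed.

Lemma prim_derive1 f (x : R) : smooth f -> f a = 0 -> a <= x ->
  prim a (derive1 f) x = f x.
Proof.
move=> sf fa; rewrite le_eqVlt => /predU1P[<-|ax].
  by rewrite /prim set_itv1 Rintegral_set1.
rewrite /prim /Rintegral (@continuous_FTC2 _ _ f)//.
- by rewrite fa -EFinB subr0.
- apply: continuous_subspaceT; exact/smooth_continuous/smooth_derive1.
- split=> [y _||].
  + exact: smooth_derivable.
  + by apply: cvg_at_right_filter; exact: smooth_continuous.
  + by apply: cvg_at_left_filter; exact: smooth_continuous.
Qed.

Lemma test_function_bd phi : test_function Omega phi -> phi a = 0 /\ phi b = 0.
Proof.
move=> [_ _ sub].
have out x : ~ Omega x -> phi x = 0.
  move=> nO; apply: contrapT => /eqP px; apply/nO/sub.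
  exact: subset_closure.
by split; apply: out; rewrite OE/= in_itv/= ltxx// andbF.
Qed.

(** This says that g is the weak derivative of its primitive; the boundary term disappears because
    phi vanishes at b. *)
Lemma prim_test_parts g phi : integ `[a, b] g -> test_function Omega phi ->
  \int[mu]_(x in `[a, b]) (prim a g x * derive1 phi x) =
  - \int[mu]_(x in `[a, b]) (g x * phi x).
Proof.
move=> gi /[dup] /test_function_bd[pa pb] [sp _ _].
have dpi : integ `[a, b] (derive1 phi).
  exact/continuous_integ/smooth_continuous/smooth_derive1.
have := prim_parts (ltW ab) dpi gi.
rewrite prim_derive1 ?(ltW ab)// pb mul0r => /eqP; rewrite addr_eq0 => /eqP H.
transitivity (\int[mu]_(x in `[a, b]) (derive1 phi x * prim a g x)).
  by apply: eq_Rintegral => x _; rewrite mulrC.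
rewrite H; congr -%R; apply: eq_Rintegral => x.
rewrite inE/= in_itv/= => /andP[ax _].
by rewrite prim_derive1// mulrC.
Qed.

Lemma ae_leb_Rintegral f g : mfun f -> measurable_fun (`[a, b] : set T) g ->
  {ae nu, forall x, f x = g x} ->
  \int[nu]_x f x = \int[mu]_(x in `[a, b]) g x.
Proof.
move=> mf mg fg; rewrite (leb_RintegralE oOmega OE)//.
have sub : `]a, b[ `<=` (`[a, b] : set T) by apply: subset_itv; rewrite bnd_simp.
rewrite /Rintegral integral_itv_bndoo; last first.
  by apply/measurable_EFinP; exact: measurable_funTS.
rewrite [in RHS]integral_itv_bndoo; last first.
  by apply/measurable_EFinP; exact: measurable_funS mg.
congr fine; apply: ae_eq_integral => //.
- by apply/measurable_EFinP; exact: measurable_funTS.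
- by apply/measurable_EFinP; exact: measurable_funS mg.
move: fg => /(ae_leb oOmega OE); apply: ae_imply => x h xab.
by rewrite h// OE.
Qed.

Lemma continuous_mfun f : {within `[a, b], continuous f} ->
  measurable_fun (`[a, b] : set T) f.
Proof.
by move=> fc; apply: subspace_continuous_measurable_fun => //; exact: measurable_itv.
Qed.

Lemma within_cst_prim k (F : Lp) :
  {within `[a, b], continuous (fun x => k + prim a F x)}.
Proof.
move=> x; apply: cvgD; first exact: cvg_cst.
by apply: (prim_continuous (ltW ab)); exact: Leb_integ.
Qed.

(** psi and the primitive of psi' have the same weak derivative, so their difference is orthogonal
    to the derivatives of all test functions and du Bois-Reymond makes it constant. *)
Lemma W1_prim (psi : W) : exists k,
  {ae nu, forall x, W1_fun psi x = k + prim a (W1_der psi) x}.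
Proof.
set f := W1_fun psi; set g := W1_der psi.
have fi := Leb_integ f; have gi := Leb_integ g.
have pc : {within `[a, b], continuous prim a g} by exact: prim_continuous (ltW ab) gi.
have mD := measurable_itvR `[a, b].
have pi : integ `[a, b] (prim a g).
  exact: continuous_compact_integrable (@segment_compact _ _ _) pc.
have hi : integ `[a, b] (fun x => f x - prim a g x).
  exact: (integrableB mD fi pi).
have [|c Hc] := du_bois_reymond ab hi.
  move=> phi tp; have [sp _ _] := tp; rewrite -OE in tp.
  have sd := smooth_derive1 sp.
  have dc : {within `[a, b], continuous (derive1 phi)}.
    exact/continuous_subspaceT/smooth_continuous.
  have := W1_derP psi tp; rewrite -/f -/g /pairing.
  rewrite !(leb_RintegralE oOmega OE); last 2 first.
  - by apply: measurable_funM; [exact: Leb_measurable|exact: smooth_mfun].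
  - by apply: measurable_funM; [exact: Leb_measurable|exact: smooth_mfun].
  rewrite -(prim_test_parts gi tp) => E.
  have i1 : integ `[a, b] (fun x => f x * derive1 phi x).
    apply: eq_integrable (integrable_contM dc fi) => // x _ /=.
    by rewrite mulrC.
  have i2 : integ `[a, b] (fun x => prim a g x * derive1 phi x).
    apply: integrable_contM => //; exact/continuous_integ/smooth_continuous.
  rewrite -[RHS](subrr (\int[mu]_(x in `[a, b]) (prim a g x * derive1 phi x))).
  rewrite -{1}E -RintegralB//.
  by apply: eq_Rintegral => x _; rewrite mulrBl.
exists c; apply/(ae_leb oOmega OE); apply: ae_imply Hc => x + Ox.
by rewrite OE in Ox => /(_ Ox) <-; rewrite subrK.
Qed.

Lemma closure_Omega : closure Omega = `[a, b]%classic.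
Proof.
rewrite OE; apply/seteqP; split; first exact: itv_closure.
move=> x /=; rewrite in_itv/= => /andP[].
rewrite le_eqVlt => /predU1P[<- _|ax].
  move=> B aB.
  have [y [yB ay yb]] : exists y, [/\ B y, a < y & y < b].
    apply: (@filter_ex _ (a^'+)); near=> y; split; near: y.
    - by rewrite near_withinE; apply: filterS aB.
    - exact: nbhs_right_gt.
    - exact: nbhs_right_lt.
  by exists y; split => //=; rewrite in_itv/= ay yb.
rewrite le_eqVlt => /predU1P[xb|xb].
  subst x => B aB.
  have [y [yB ay yb]] : exists y, [/\ B y, a < y & y < b].
    apply: (@filter_ex _ (b^'-)); near=> y; split; near: y.
    - by rewrite near_withinE; apply: filterS aB.
    - exact: nbhs_left_gt.
    - exact: nbhs_left_lt.
  by exists y; split => //=; rewrite in_itv/= ay yb.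
by apply: subset_closure; rewrite /= in_itv/= ax xb.
Unshelve. all: by end_near. Qed.

(** A point of disagreement would bring a whole interval of disagreement, of positive length. *)
Lemma continuous_ae_eq f g : {within `[a, b], continuous f} ->
  {within `[a, b], continuous g} -> {ae nu, forall x, f x = g x} ->
  forall x, a <= x <= b -> f x = g x.
Proof.
move=> fc gc fg x /andP[ax xb]; apply: contrapT => /eqP fgx.
have dc : {within `[a, b], continuous (fun x => f x - g x)}.
  by move=> y; apply: cvgB; [exact: fc|exact: gc].
have d0 : 0 < `|f x - g x| by rewrite normr_gt0 subr_eq0.
have := (subspace_continuousP _ _).1 dc x; rewrite /= in_itv/= ax xb => /(_ isT).
move=> /cvgrPdist_lt /(_ _ d0).
rewrite near_withinE => /nbhs_ballP[e /= e0 He].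
have [A [mA A0 NA]] := (ae_leb oOmega OE _).1 fg.
have {}e0 : (0 : R) < e by exact: e0.
(* The neighbourhood of x is cut down to ]a, b[, since x may be an endpoint; it stays nonempty. *)
pose c := Num.max a (x - e); pose d := Num.min b (x + e).
have cd : c < d.
  by rewrite /c /d gt_max !lt_min; apply/andP; split; apply/andP; split => //; lra.
have sub : `]c, d[%classic `<=` A.
  move=> y /=; rewrite in_itv/= gt_max lt_min => /andP[/andP[ay xey] /andP[yb yxe]].
  apply: NA => /=; apply/not_implyP; split.
    by rewrite OE/= in_itv/= ay.
  have xey' : ball x e y by rewrite /ball/= ltr_norml; apply/andP; split; lra.
  have yab : `[a, b]%classic y by rewrite /= in_itv/= !ltW.
  move=> fgy; have := He y xey' yab.
  by rewrite /from_subspace fgy subrr subr0 ltxx.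
have : (mu `]c, d[ <= mu A)%E.
  by apply: le_measure => //; rewrite inE//; exact: measurable_itv.
by rewrite A0 lebesgue_measure_itv/= lte_fin cd -EFinB lee_fin subr_le0 leNgt cd.
Qed.

(** The trace reads a representative picked by choice. The primitive shows that one exists, and any
    two agree on the closed interval, so the primitive computes the trace. *)
Lemma traceE (psi : W) k :
  {ae nu, forall x, W1_fun psi x = k + prim a (W1_der psi) x} ->
  forall x, a <= x <= b -> trace psi x = k + prim a (W1_der psi) x.
Proof.
move=> psiE; have kc : {within `[a, b], continuous (fun x => k + prim a (W1_der psi) x)}.
  exact: within_cst_prim.
rewrite /trace /continuous_representative.
set S := [set g | _].
have [c1 c2] : S (xget (cst 0) S).
  apply: xgetPex; exists (fun x => k + prim a (W1_der psi) x); split.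
    by rewrite closure_Omega.
  by apply: ae_imply psiE => x ->.
apply: continuous_ae_eq => //; first by rewrite -closure_Omega.
by apply: ae_imply2 c2 psiE => x -> ->.
Qed.

Lemma W1_make k (g : Lp) : exists2 psi : W, W1_der psi = g &
  {ae nu, forall x, W1_fun psi x = k + prim a g x}.
Proof.
have kc : {within `[a, b], continuous (fun x => k + prim a g x)}.
  exact: within_cst_prim.
have gi := Leb_integ g.
have [F FE] := continuous_Leb oOmega ab OE p1 kc.
suff wd : weak_derivative oOmega F g by exists (MkW1 wd).
move=> phi tp; have [sp _ _] := tp.
have sd := smooth_derive1 sp.
have dc : {within `[a, b], continuous (derive1 phi)}.
  exact/continuous_subspaceT/smooth_continuous.
have dpi : integ `[a, b] (derive1 phi) by exact/continuous_integ/smooth_continuous.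
have mD := measurable_itvR `[a, b].
rewrite /pairing (@ae_leb_Rintegral _ (fun x => (k + prim a g x) * derive1 phi x)); first last.
- by apply: ae_imply FE => x ->.
- by apply: measurable_funM; exact: continuous_mfun.
- by apply: measurable_funM; [exact: Leb_measurable|exact: smooth_mfun].
rewrite (leb_RintegralE oOmega OE); last first.
  by apply: measurable_funM; [exact: Leb_measurable|exact: smooth_mfun].
rewrite -(prim_test_parts gi tp).
under eq_Rintegral do rewrite mulrDl.
have [pa pb] := test_function_bd tp.
rewrite RintegralD//; last first.
- by apply: integrable_contM => //; exact: prim_continuous (ltW ab) gi.
- exact: (integrableZl mD k dpi).
rewrite RintegralZl// -[X in k * X]/(prim a _ b) prim_derive1 ?(ltW ab)//.
by rewrite pb mulr0 add0r.
Qed.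

Lemma W1_eqP (psi1 psi2 : W) : W1_fun psi1 = W1_fun psi2 ->
  W1_der psi1 = W1_der psi2 -> psi1 = psi2.
Proof.
case: psi1 psi2 => [f1 g1 w1] [f2 g2 w2] /= fE gE; subst f2 g2.
by rewrite (Prop_irrelevance w1 w2).
Qed.

End sobolev_interval.

(** * The domain as an interval, and counting integrals on its two endpoints *)

Section interval_topology.
Context {R : realType}.

Lemma open_bounded_connectedE (Omega : set R) : open Omega -> bounded_set Omega ->
  Omega !=set0 -> connected Omega ->
  exists a b : R, a < b /\ Omega = `]a, b[%classic.
Proof.
move=> oO [M [_ HM]] O0 /connected_intervalP cO.
have bd x : Omega x -> `|x| <= `|M| + 1.
  by apply: HM; rewrite (le_lt_trans (ler_norm M))// ltrDl.
have hs : has_sup Omega.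
  by split => //; exists (`|M| + 1) => x /bd; exact/le_trans/ler_norm.
have hi : has_inf Omega.
  split => //; exists (- (`|M| + 1)) => x /bd.
  by rewrite ler_norml => /andP[].
have OE : Omega = `]inf Omega, sup Omega[%classic.
  apply/seteqP; split => x /=; rewrite in_itv/=.
    move=> Ox; have /nbhs_ballP[e /= e0 He] : nbhs x Omega by exact: open_nbhs_nbhs.
    have e2 : 0 < e / 2 by rewrite divr_gt0.
    have h1 : Omega (x - e / 2).
      by apply: He; rewrite /ball/= opprB addrCA subrr addr0 gtr0_norm// ltr_pdivrMr// ltr_pMr// ltr1n.
    have h2 : Omega (x + e / 2).
      by apply: He; rewrite /ball/= opprD addrA subrr sub0r normrN gtr0_norm// ltr_pdivrMr// ltr_pMr// ltr1n.
    apply/andP; split.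
      by apply: (le_lt_trans (ge_inf hi.2 h1)); rewrite gtrBl.
    by apply: lt_le_trans (ub_le_sup hs.2 h2); rewrite ltrDl.
  move=> /andP[ix xs].
  have [y Oy yx] := inf_lt O0 ix.
  have [z Oz xz] := sup_gt O0 xs.
  by apply: (cO y z) => //; rewrite !ltW.
exists (inf Omega), (sup Omega); split => //.
case: O0 => x; rewrite {1}OE/= in_itv/= => /andP[]; exact: lt_trans.
Qed.

Lemma boundary_itv (a b : R) : a < b -> boundary (`]a, b[%classic : set R) = [set a; b].
Proof.
move=> ab; rewrite /boundary (closure_Omega ab erefl).
rewrite (_ : _°%classic = `]a, b[%classic); last first.
  by apply/interior_id; exact: itv_open.
apply/seteqP; split => x /=; rewrite !in_itv/=.
  move=> [/andP[ax xb] /negP]; rewrite negb_and -!leNgt => /orP[xa|bx].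
    by left; apply/le_anti; rewrite xa.
  by right; apply/le_anti; rewrite xb.
by case=> ->; rewrite !lexx ltxx ?andbF (ltW ab).
Qed.

Lemma Vol0_eq0 (S : set R) : (Vol0 S == 0%E) = (S == set0).
Proof.
apply/idP/idP => [|/eqP ->]; last by rewrite /Vol0 measure0.
rewrite /Vol0 /counting; case: ifPn => // /asboolP fS.
rewrite eqe pnatr_eq0 finmap.cardfs_eq0 => /eqP /fset_set_set0 -> //.
Qed.

Lemma Rintegral_counting1 (x : R) (h : R -> R) :
  \int[@counting R R]_(t in [set x]) h t = h x.
Proof.
rewrite (@eq_Rintegral _ _ _ _ _ (cst (h x))); last first.
  by move=> t /set_mem ->.
rewrite [LHS](Rintegral_cst _ (measurable_set1 x) (h x)) /= /counting asboolT//.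
by rewrite fset_set1 finmap.cardfs1 mulr1.
Qed.

(** The membership factors give one formula for every set of endpoints, so the boundary term never
    requires a case distinction. *)
Lemma Rintegral_counting2 (a b : R) (S : set R) (h : R -> R) : a != b ->
  S `<=` [set a; b] ->
  \int[@counting R R]_(t in S) h t = h a * (a \in S)%:R + h b * (b \in S)%:R.
Proof.
move=> ab Sab.
have fin A : A `<=` [set a; b] -> finite_set A.
  by move=> /sub_finite_set; apply; exact: finite_set2.
have mA A : A `<=` [set a; b] -> measurable A.
  by move=> /fin fA; apply: countable_measurable => //; exact: finite_set_countable.
have point x : x = a \/ x = b ->
    \int[@counting R R]_(t in S `&` [set x]) h t = h x * (x \in S)%:R.
  move=> xab; have [xS|xS] := boolP (x \in S).
    rewrite (_ : S `&` [set x] = [set x]) ?Rintegral_counting1 ?mulr1//.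
    by apply: setIidr => _ ->; exact: set_mem.
  rewrite (_ : S `&` [set x] = set0) ?Rintegral_set0 ?mulr0//.
  apply/seteqP; split => // y [Sy yx]; move: xS; rewrite notin_setE; apply.
  by rewrite -yx.
have SE : S = (S `&` [set a]) `|` (S `&` [set b]).
  by rewrite -setIUr setIidl.
rewrite {1}SE Rintegral_setU.
- by rewrite !point//; [right|left].
- by apply: mA => x [Sx _]; exact: Sab.
- by apply: mA => x [Sx _]; exact: Sab.
- rewrite -SE; apply: measurable_bounded_integrable; first exact: mA.
  + by rewrite /= /counting asboolT ?ltry//; exact: fin.
  + by move=> _ Y mY; apply: mA => x [Sx _]; exact: Sab.
  + exists (Num.max `|h a| `|h b|); split; rewrite ?num_real// => M hM x Sx.
    move: hM; rewrite gt_max => /andP[ha hb].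
    by case: (Sab _ Sx) => ->; exact: ltW.
- apply/disj_setPS => x [[_ /= ->] [_ /= abE]].
  by rewrite abE eqxx in ab.
Qed.

End interval_topology.

(** * The two weak equations *)

Section weak_formulation.
Context {R : realType} (Omega : set R) (oOmega : open Omega) (a b : R).
Hypotheses (ab : a < b) (OE : Omega = `]a, b[%classic).
Local Notation mu := (@lebesgue_measure R).
Local Notation integ D f := (mu.-integrable D (EFin \o f)).
Local Notation T := (measurableTypeR R).
Local Notation nu := (leb oOmega).
Local Notation mfun f := (measurable_fun [set: T] (f : T -> T)).
Local Notation I f := (\int[mu]_(x in `[a, b]) f x).
Implicit Types (f g : R -> R).

Lemma primaa f : prim a f a = 0.
Proof. by rewrite /prim set_itv1 Rintegral_set1. Qed.

Lemma prim_indic (x : R) (f : R -> R) : a <= x -> x <= b ->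
  \int[mu]_(t in `[a, b]) (\1_(`[a, x]) t * f t) = prim a f x.
Proof.
move=> ax xb; rewrite /prim Rintegral_mkcond [RHS]Rintegral_mkcond.
apply: eq_Rintegral => t _; rewrite !patchE indicE.
have [tx|tx] := boolP (t \in `[a, x]%classic); last by rewrite mul0r; case: ifP.
rewrite mul1r mem_set//; apply: subset_itv (set_mem tx); rewrite bnd_simp//.
Qed.

Lemma prim_eq_ae f g : integ `[a, b] f -> integ `[a, b] g ->
  (forall x, a <= x <= b -> prim a f x = prim a g x) ->
  {ae nu, forall x, f x = g x}.
Proof.
move=> fi gi fg; apply/(ae_leb oOmega OE).
have fgi : integ `[a, b] (fun x => f x - g x).
  exact: (integrableB (measurable_itvR `[a, b]) fi gi).
apply: ae_imply (prim_eq0_ae fgi _) => [x + Ox|x].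
  by rewrite OE in Ox => /(_ Ox)/eqP; rewrite subr_eq0 => /eqP.
rewrite in_itv/= => /andP[/ltW ax /ltW xb].
have xS h : integ `[a, b] h -> integ `[a, x] h.
  by move=> hi; exact: integrable_itvS hi _ xb.
rewrite /prim RintegralB//; [|exact: xS..].
by rewrite -!/(prim a _ x) fg ?subrr// ax.
Qed.

Section Sobolev.
Context (p : R) (p1 : (1 <= p%:E)%E).
Local Notation Lp := (Leb oOmega p1).
Local Notation W := (W1 oOmega p1).

Lemma W1_repr (psi : W) :
  {ae nu, forall x, W1_fun psi x = trace psi a + prim a (W1_der psi) x} /\
  forall x, a <= x <= b -> trace psi x = trace psi a + prim a (W1_der psi) x.
Proof.
have [k Hk] := W1_prim ab OE psi.
have tE := traceE ab OE Hk.
have ka : trace psi a = k by rewrite tE ?lexx ?ltW// primaa addr0.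
by rewrite ka.
Qed.

Lemma W1_ext (psi1 psi2 : W) : W1_der psi1 = W1_der psi2 ->
  trace psi1 a = trace psi2 a -> psi1 = psi2.
Proof.
move=> dE tE; apply: W1_eqP => //; apply: Leb_eqP.
have [h1 _] := W1_repr psi1; have [h2 _] := W1_repr psi2.
by apply: ae_imply2 h1 h2 => x -> ->; rewrite dE tE.
Qed.

(** With [W1_ext], this makes psi determined by, and freely prescribed through, the pair (psi(a),
    psi'). *)
Lemma W1_exists k (g : Lp) : exists2 psi : W, W1_der psi = g & trace psi a = k.
Proof.
have [psi dE h] := W1_make ab OE k g; exists psi => //.
rewrite -dE in h.
by rewrite (traceE ab OE h) ?lexx ?ltW// primaa addr0.
Qed.

(** These are the test functions of all later uniqueness arguments: pairing with one of them
    evaluates a primitive at x. *)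
Lemma indic_Leb (x : R) : exists g : Lp, {ae nu, forall t, g t = \1_(`[a, x]) t}.
Proof.
apply: Lfun_Leb; apply: (Lfun_bounded oOmega ab OE p1 (M := 1)).
  exact: measurable_indic.
by move=> t; rewrite indicE; case: (_ \in _); rewrite ?normr1 ?normr0.
Qed.

Lemma pairing_indic (x : R) (g : R -> R) f : a <= x <= b ->
  mfun g -> {ae nu, forall t, g t = \1_(`[a, x]) t} -> mfun f ->
  pairing oOmega g f = prim a f x.
Proof.
move=> /andP[ax xb] mg gE mf; rewrite -prim_indic//.
rewrite /pairing; apply: (ae_leb_Rintegral (oOmega := oOmega) OE).
- exact: measurable_funM.
- apply: measurable_funM; last exact: measurable_funTS.
  exact: measurable_indic.
- by apply: ae_imply gE => t ->.
Qed.

Lemma pairing_continuous (g : Lp) (u U : R -> R) : mfun u ->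
  {within `[a, b], continuous U} -> {ae nu, forall x, u x = U x} ->
  pairing oOmega g u = I (fun x => g x * U x).
Proof.
move=> mu_ Uc uU; rewrite /pairing.
apply: (ae_leb_Rintegral (oOmega := oOmega) OE).
- by apply: measurable_funM => //; exact: Leb_measurable.
- apply: measurable_funM; last exact: continuous_mfun.
  by apply: measurable_funTS; exact: Leb_measurable.
- by apply: ae_imply uU => x ->.
Qed.

Lemma integrable_Leb_contM (F : Lp) f : {within `[a, b], continuous f} ->
  integ `[a, b] (fun x => F x * f x).
Proof.
move=> fc; apply: eq_integrable (integrable_contM fc (Leb_integ ab OE F)) => //.
by move=> x _; rewrite /= mulrC.
Qed.

Lemma prim_Leb_continuous (F : Lp) : {within `[a, b], continuous prim a F}.
Proof. by apply: (prim_continuous (ltW ab)); exact: Leb_integ. Qed.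

(** With Q the primitive of q vanishing at a, the integral of q psi is psi(b) Q(b) minus that of
    psi' Q; psi(b) is then expanded as psi(a) plus the integral of psi'. *)
Lemma W1_load (pq : R) (pq1 : (1 <= pq%:E)%E) (q : Leb oOmega pq1) (psi : W) :
  \int[nu]_x (q x * W1_fun psi x) =
  (trace psi a + prim a (W1_der psi) b) * prim a q b -
  I (fun x => W1_der psi x * prim a q x).
Proof.
have [h _] := W1_repr psi; set k := trace psi a in h *.
set g := W1_der psi in h *.
have qi : integ `[a, b] (q : R -> R) by exact: Leb_integ.
have gi : integ `[a, b] (g : R -> R) by exact: Leb_integ.
have gc : {within `[a, b], continuous prim a g} by exact: prim_Leb_continuous.
have mD := measurable_itvR `[a, b].
rewrite (@ae_leb_Rintegral _ _ oOmega _ _ OE _ (fun x => q x * (k + prim a g x))); first last.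
- by apply: ae_imply h => x ->.
- apply: measurable_funM; last by apply: continuous_mfun; exact: within_cst_prim.
  by apply: measurable_funTS; exact: Leb_measurable.
- by apply: measurable_funM; exact: Leb_measurable.
have i1 : integ `[a, b] (fun x => k * q x) by exact: (integrableZl mD k qi).
have i2 : integ `[a, b] (fun x => q x * prim a g x).
  apply: eq_integrable (integrable_contM gc qi) => // x _.
  by rewrite /= mulrC.
transitivity (I (fun x => k * q x + q x * prim a g x)).
  by apply: eq_Rintegral => x _; ring.
rewrite RintegralD// RintegralZl// -/(prim a q b).
have -> : I (fun x => q x * prim a g x) =
    prim a q b * prim a g b - I (fun x => prim a q x * g x).
  by rewrite -(prim_parts (ltW ab) qi gi) addrK.
rewrite (_ : I (fun x => prim a q x * g x) = I (fun x => g x * prim a q x)); first ring.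
by apply: eq_Rintegral => x _; rewrite mulrC.
Qed.

Lemma prim1 (x : R) : a <= x -> prim a (cst 1) x = x - a.
Proof.
move=> ax; rewrite /prim [LHS](Rintegral_cst mu (measurable_itvR `[a, x]) 1) mul1r.
have := lebesgue_measure_itv `[a, x] => /= ->; rewrite lte_fin.
by case: ltP => //= xa; apply/eqP; rewrite eq_sym subr_eq0 eq_le xa.
Qed.

(** Integrating the primitive of psi' by parts against x - a, the primitive of 1, leaves the weight
    b - x; this is the origin of the kernel for the zero-mean constraint. *)
Lemma W1_mean (psi : W) :
  (fine (mu Omega))^-1 * \int[nu]_x W1_fun psi x =
  trace psi a + I (fun x => W1_der psi x * ((b - x) / (b - a))).
Proof.
have [h _] := W1_repr psi; set k := trace psi a in h *.
set g := W1_der psi in h *.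
have gi : integ `[a, b] (g : R -> R) by exact: Leb_integ.
have gc : {within `[a, b], continuous prim a g} by exact: prim_Leb_continuous.
have mD := measurable_itvR `[a, b].
have oi : integ `[a, b] (cst 1 : R -> R) by apply: continuous_integ => x; exact: cvg_cst.
have ba : b - a != 0 by rewrite subr_eq0 gt_eqF.
have -> : fine (mu Omega) = b - a.
  by rewrite OE lebesgue_measure_itv/= lte_fin ab.
rewrite (@ae_leb_Rintegral _ _ oOmega _ _ OE _ (fun x => k + prim a g x)); first last.
- exact: h.
- by apply: continuous_mfun; exact: within_cst_prim.
- exact: Leb_measurable.
have pi : integ `[a, b] (prim a g).
  exact: continuous_compact_integrable (@segment_compact _ _ _) gc.
have ki : integ `[a, b] (fun=> k) by apply: continuous_integ => x; exact: cvg_cst.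
rewrite RintegralD//.
have -> : I (fun=> k) = k * (b - a).
  rewrite [LHS](Rintegral_cst mu mD k); congr (_ * _).
  by have := lebesgue_measure_itv `[a, b] => /= ->; rewrite lte_fin ab.
have pc1 : {within `[a, b], continuous prim a (cst 1)}.
  exact: prim_continuous (ltW ab) oi.
have i1 : integ `[a, b] (fun x => prim a (cst 1) x * g x).
  exact: integrable_contM.
have i2 : integ `[a, b] (fun x => (b - a) * g x) by exact: (integrableZl mD (b - a) gi).
have i3 : integ `[a, b] (fun x => (b - a) * g x - prim a (cst 1) x * g x).
  exact: (integrableB mD i2 i1).
have -> : I (fun x => g x * ((b - x) / (b - a))) =
    (b - a)^-1 * I (fun x => (b - a) * g x - prim a (cst 1) x * g x).
  rewrite -[RHS]RintegralZl//; apply: eq_Rintegral => x /set_mem/=.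
  by rewrite in_itv/= => /andP[ax _]; rewrite prim1//; field.
rewrite RintegralB// RintegralZl// -/(prim a g b).
have := prim_parts (ltW ab) oi gi; rewrite prim1 ?(ltW ab)//.
rewrite (_ : I (fun x => cst 1 x * prim a g x) = I (fun x => prim a g x)).
  by move=> <-; field.
by apply: eq_Rintegral => x _; rewrite mul1r.
Qed.

End Sobolev.

End weak_formulation.

(** * Solving each weak equation: velocity from the boundary data, pressure from the drag *)

Section boundary_value_problem.
Context {R : realType} (Omega : set R) (oOmega : open Omega) (a b : R).
Hypotheses (ab : a < b) (OE : Omega = `]a, b[%classic).
Local Notation mu := (@lebesgue_measure R).
Local Notation integ D f := (mu.-integrable D (EFin \o f)).
Local Notation T := (measurableTypeR R).
Local Notation nu := (leb oOmega).
Local Notation mfun f := (measurable_fun [set: T] (f : T -> T)).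
Local Notation I f := (\int[mu]_(x in `[a, b]) f x).
Context (p p' : R) (p1 : (1 <= p%:E)%E) (p1' : (1 <= p'%:E)%E).
Local Notation Lp := (Leb oOmega p1).
Local Notation Lp' := (Leb oOmega p1').
Local Notation W := (W1 oOmega p1).
Implicit Types (f g : R -> R) (Sigma_v Sigma_p : set R) (psi : W).

Lemma prim_der psi : trace psi b = trace psi a + prim a (W1_der psi) b.
Proof. by have [_ ->] := W1_repr ab OE psi; rewrite // lexx ltW. Qed.

(* The kernel is (b - x) / (b - a), 0 or 1 according as Sigma_p is empty, {a}
   or {b}. *)
Lemma W1_0_kernel Sigma_p : Sigma_p `<=` [set a; b] ->
  ~ (Sigma_p a /\ Sigma_p b) ->
  exists2 kappa : R -> R, {within `[a, b], continuous kappa} &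
    forall psi, W1_0 Sigma_p psi <->
      trace psi a = - I (fun x => W1_der psi x * kappa x).
Proof.
move=> Sab nab; rewrite /W1_0 Vol0_eq0; have [S0|/set0P[z Sz]] := eqVneq.
  exists (fun x => (b - x) / (b - a)).
    apply: continuous_subspaceT => x; apply: cvgM; last exact: cvg_cst.
    by apply: cvgB; [exact: cvg_cst|exact: cvg_id].
  move=> psi; rewrite (W1_mean ab OE); split => [/eqP|->]; last by rewrite addNr.
  by rewrite addr_eq0 => /eqP.
have [za|zb] := Sab _ Sz.
  exists (cst 0); first by move=> x; exact: cvg_cst.
  have I0 psi : I (fun x => W1_der psi x * cst 0 x) = 0.
    rewrite -[RHS](mul0r (fine (mu `[a, b]))) -Rintegral_cst//.
    by apply: eq_Rintegral => x _; rewrite mulr0.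
  move=> psi; rewrite I0 oppr0; split=> [|psia x Sx]; first by apply; rewrite -za.
  have [->//|xb] := Sab _ Sx; exfalso; apply: nab.
  by rewrite -{1}za -xb.
exists (cst 1); first by move=> x; exact: cvg_cst.
have I1 psi : I (fun x => W1_der psi x * cst 1 x) = prim a (W1_der psi) b.
  by apply: eq_Rintegral => x _; rewrite mulr1.
move=> psi; rewrite I1; split=> [h|psia x Sx].
  have : trace psi b = 0 by apply: h; rewrite -zb.
  by rewrite prim_der => /eqP; rewrite addr_eq0 => /eqP.
have [xa|->] := Sab _ Sx; last by rewrite prim_der psia addNr.
by exfalso; apply: nab; rewrite -{1}xa -zb.
Qed.

Lemma W1_0_dirichlet psi :
  W1_0 [set a; b] psi <-> trace psi a = 0 /\ prim a (W1_der psi) b = 0.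
Proof.
rewrite /W1_0 Vol0_eq0 ifF; last first.
  by apply/negbTE/set0P; exists a; left.
split=> [h|[ta pb] x [->//|->]]; last by rewrite prim_der ta pb addr0.
have ta : trace psi a = 0 by apply: h; left.
by split => //; have := h b (or_intror erefl); rewrite prim_der ta add0r.
Qed.

Lemma W1_0_load Sigma_v (q : Lp') (u0 : R -> R) psi : Sigma_v `<=` [set a; b] ->
  - (\int[nu]_x (q x * W1_fun psi x))
    + \int[@counting R R]_(x in Sigma_v) (u0 x * trace psi x) =
  trace psi a * (u0 a * (a \in Sigma_v)%:R + u0 b * (b \in Sigma_v)%:R - prim a q b)
  + prim a (W1_der psi) b * (u0 b * (b \in Sigma_v)%:R - prim a q b)
  + I (fun x => W1_der psi x * prim a q x).
Proof.
move=> Sab; rewrite (Rintegral_counting2 _ _ Sab) ?lt_eqF//.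
rewrite (W1_load ab OE) prim_der; ring.
Qed.

Lemma RintegralZ_prim (k : R) (g : Lp) : I (fun x => k * g x) = k * prim a g b.
Proof. by rewrite RintegralZl//; exact: Leb_integ. Qed.

Lemma W1_0_velocity Sigma_v Sigma_p (q : Lp') (u0 kappa : R -> R) :
  Sigma_v `<=` [set a; b] -> {within `[a, b], continuous kappa} ->
  (forall psi, W1_0 Sigma_p psi <->
    trace psi a = - I (fun x => W1_der psi x * kappa x)) ->
  exists2 U : R -> R, {within `[a, b], continuous U} &
    forall psi, W1_0 Sigma_p psi ->
      - (\int[nu]_x (q x * W1_fun psi x))
      + \int[@counting R R]_(x in Sigma_v) (u0 x * trace psi x) =
      I (fun x => W1_der psi x * U x).
Proof.
move=> Sab kc Hk; have mD := measurable_itvR `[a, b].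
(* In the load, [B] is the coefficient of the integral of psi' and [AB] that of psi(a); substituting
   the kernel expression for psi(a) gives U = Q + B - AB kappa. *)
pose B := u0 b * (b \in Sigma_v)%:R - prim a q b.
pose AB := u0 a * (a \in Sigma_v)%:R + B.
have qc : {within `[a, b], continuous prim a q} by exact: prim_Leb_continuous.
exists (fun x => prim a q x + (B - AB * kappa x)).
  move=> x; apply: cvgD; first exact: qc.
  apply: cvgB; first exact: cvg_cst.
  by apply: cvgM; [exact: cvg_cst|exact: kc].
move=> psi /Hk psia; rewrite W1_0_load//; set g := W1_der psi in psia *.
have gi : integ `[a, b] (g : R -> R) by exact: Leb_integ.
have i1 : integ `[a, b] (fun x => g x * prim a q x) by exact: integrable_Leb_contM.
have i2 : integ `[a, b] (fun x => g x * kappa x) by exact: integrable_Leb_contM.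
have i3 : integ `[a, b] (fun x => B * g x) by exact: (integrableZl mD B gi).
have i4 : integ `[a, b] (fun x => AB * (g x * kappa x)).
  exact: (integrableZl mD AB i2).
have i5 : integ `[a, b] (fun x => B * g x - AB * (g x * kappa x)).
  exact: (integrableB mD i3 i4).
rewrite [RHS](_ : _ = I (fun x => g x * prim a q x + (B * g x - AB * (g x * kappa x)))); last first.
  by apply: eq_Rintegral => x _; ring.
rewrite RintegralD// RintegralB// RintegralZ_prim RintegralZl// psia /AB /B; ring.
Qed.

(** The constraint fixes psi(a) only, so each g in L^p is the derivative of an admissible psi.
    Taking for g the indicators of [a, x] identifies the primitives of u and U. *)
Lemma velocity_unique Sigma_p (kappa U : R -> R) (u : Lp') :
  {within `[a, b], continuous U} ->
  (forall psi, W1_0 Sigma_p psi <->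
    trace psi a = - I (fun x => W1_der psi x * kappa x)) ->
  (forall psi, W1_0 Sigma_p psi ->
    pairing oOmega (W1_der psi) u = I (fun x => W1_der psi x * U x)) ->
  {ae nu, forall x, u x = U x}.
Proof.
move=> Uc Hk Hu; have [V VU] := continuous_Leb oOmega ab OE p1' Uc.
suff uV : {ae nu, forall x, u x = V x} by apply: ae_imply2 uV VU => x -> ->.
have ui : integ `[a, b] (u : R -> R) by exact: Leb_integ.
have Vi : integ `[a, b] (V : R -> R) by exact: Leb_integ.
apply: (prim_eq_ae oOmega OE ui Vi) => x xab.
have [g gE] := indic_Leb oOmega ab OE p1 x.
have [psi dE tE] := W1_exists ab OE (- I (fun x => g x * kappa x)) g.
have psi0 : W1_0 Sigma_p psi by apply/Hk; rewrite dE tE.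
have := Hu _ psi0; rewrite dE -(pairing_continuous OE _ (Leb_measurable V) Uc VU).
by rewrite !(pairing_indic OE xab (Leb_measurable g) gE); [|exact: Leb_measurable..].
Qed.

Lemma pairing_inj (g : Lp) f : mfun f -> integ `[a, b] f ->
  (forall phi : Lp', pairing oOmega g phi = pairing oOmega f phi) <->
  {ae nu, forall x, g x = f x}.
Proof.
move=> mf fi; split=> [H|gf phi]; last first.
  rewrite /pairing /Rintegral; congr fine; apply: ae_eq_integral => //.
  - by apply/measurable_EFinP/measurable_funM; exact: Leb_measurable.
  - by apply/measurable_EFinP/measurable_funM => //; exact: Leb_measurable.
  - by apply: ae_imply gf => x -> _.
have gi : integ `[a, b] (g : R -> R) by exact: Leb_integ.
apply: (prim_eq_ae oOmega OE gi fi) => x xab.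
have [phi phiE] := indic_Leb oOmega ab OE p1' x.
have := H phi.
have C h : pairing oOmega h phi = pairing oOmega phi h.
  by apply: eq_Rintegral => y _; rewrite mulrC.
by rewrite !C !(pairing_indic OE xab (Leb_measurable phi) phiE).
Qed.

Lemma pressure_flux (F : R -> R) (lam : Lp) (pr : W) :
  F \in Lfun nu p%:E ->
  (forall phi : Lp', pairing oOmega lam phi =
     pairing oOmega (fun x => - W1_der pr x + F x) phi) <->
  {ae nu, forall x, W1_der pr x = F x - lam x}.
Proof.
move=> FL; have [mF _] := (mem_LfunP _ _ _).1 FL.
have Li := (Leb_integ ab OE (W1_der pr)).
have Fi : integ `[a, b] F.
  by apply/(leb_integrableE oOmega OE) => //; exact: (Lfun_leb_integrable ab OE p1 FL).
have m : mfun (fun x => - W1_der pr x + F x).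
  by apply: measurable_funD => //; apply: measurableT_comp => //; exact: Leb_measurable.
have i : integ `[a, b] (fun x => - W1_der pr x + F x).
  have := integrableB (measurable_itvR `[a, b]) Fi Li.
  by apply: eq_integrable => // x _; rewrite /= -EFinB addrC.
rewrite (pairing_inj lam m i); split; apply: ae_imply => x ->; ring.
Qed.

(** The value at a is prescribed as a functional [k] of the derivative, because the kernel condition
    expresses p(a) through an integral of p'. *)
Lemma pressure_exists (F : R -> R) (lam : Lp) : F \in Lfun nu p%:E ->
  forall k : Lp -> R, exists2 pr : W,
    {ae nu, forall x, W1_der pr x = F x - lam x} &
    trace pr a = k (W1_der pr).
Proof.
move=> FL k.
have GL : (fun x => F x + -1 * lam x) \in Lfun nu p%:E.
  by apply: Lfun_add => //; apply: Lfun_scalel => //; exact: Leb_Lfun.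
have [G GE] := Lfun_Leb p1 GL.
have [pr dE tE] := W1_exists ab OE (k G) G.
exists pr; last by rewrite dE.
by rewrite dE; apply: ae_imply GE => x ->; rewrite mulN1r.
Qed.

End boundary_value_problem.

(** * Selecting a drag with prescribed mean *)

Lemma conj_exp_gt1 {R : realType} (r : R) : 1 < r -> 1 < conj_exp r.
Proof.
by move=> r1; rewrite /conj_exp ltr_pdivlMr ?subr_gt0// mul1r ltrBlDr ltrDl.
Qed.

Section selection.
Context {R : realType} (Omega : set R) (oOmega : open Omega) (a b : R).
Hypotheses (ab : a < b) (OE : Omega = `]a, b[%classic).
Context (r : R) (hr : 1 < r).
Local Notation mu := (@lebesgue_measure R).
Local Notation integ D f := (mu.-integrable D (EFin \o f)).
Local Notation T := (measurableTypeR R).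
Local Notation nu := (leb oOmega).
Local Notation mfun f := (measurable_fun [set: T] (f : T -> T)).
Local Notation I f := (\int[mu]_(x in `[a, b]) f x).
Local Notation s := (conj_exp r).
Local Notation Lr := (Leb oOmega (gt1_leE hr)).
Local Notation Ls := (Leb oOmega (conj_gt1_leE hr)).
Implicit Types (Lambda : Lr -> set Ls) (Q : R -> R) (U : R -> Lr).

Lemma Lnrm_cst (p d : R) : 0 < p -> Lnrm oOmega p (fun=> d) = `|d| * (b - a) `^ p^-1.
Proof.
move=> p0; rewrite /Lnrm unlock /=.
rewrite [X in fine (poweR X _)](_ : _ = (`|d| `^ p * (b - a))%:E)%E.
  rewrite /= powRM ?powR_ge0 ?subr_ge0 ?(ltW ab)//.
  by rewrite -powRrM mulfV ?gt_eqF// powRr1.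
rewrite (eq_integral (cst (`|d| `^ p)%:E)); last by move=> x _.
by rewrite integral_cst// (leb_setT oOmega ab OE) EFinM.
Qed.

Lemma Leb_cvg_shift U Q (c : R) (c_ : nat -> R) :
  (forall c, {ae nu, forall x, U c x = Q x + c}) ->
  c_ n @[n --> \oo] --> c -> Leb_cvg (fun n => U (c_ n)) (U c).
Proof.
move=> HU cc; rewrite /Leb_cvg.
have -> : (fun n => Lnrm oOmega r (fun x => U (c_ n) x - U c x)) =
    (fun n => `|c_ n - c| * (b - a) `^ r^-1).
  apply/funext => n; rewrite -Lnrm_cst; last by rewrite (lt_trans ltr01).
  apply: ae_eq_Lnrm.
  - by apply: measurable_funB; exact: Leb_measurable.
  - exact: measurable_cst.
  - by apply: ae_imply2 (HU (c_ n)) (HU c) => x -> ->; rewrite opprD addrACA subrr add0r.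
rewrite -(mul0r ((b - a) `^ r^-1)) -(normr0 R) -(subrr c).
by apply: cvgMl; apply: cvg_norm; apply: cvgB => //; exact: cvg_cst.
Qed.

Lemma Leb_cvg_Rintegral (lam_ : nat -> Ls) (lam : Ls) : Leb_cvg lam_ lam ->
  \int[nu]_x lam_ n x @[n --> \oo] --> \int[nu]_x lam x.
Proof.
move=> H; have [K K0 HK] := Lfun_Rintegral_le oOmega ab OE (conj_exp_gt1 hr).
have dL n : (fun x => lam_ n x - lam x) \in Lfun nu s%:E.
  rewrite (_ : (fun x => _) = fun x => lam_ n x + -1 * lam x).
    apply: (Lfun_add (conj_gt1_leE hr)); first exact: Leb_Lfun.
    by apply: (Lfun_scalel (conj_gt1_leE hr)); exact: Leb_Lfun.
  by apply/funext => x; rewrite mulN1r.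
apply/cvgrPdist_le => e e0.
have eK : 0 < e / K by rewrite divr_gt0.
move/cvgr0Pnorm_le : H => /(_ _ eK); apply: filterS => n Hn.
have [di dB] := HK _ (dL n).
rewrite distrC -RintegralB//; try exact: (Leb_integrable ab OE).
apply: (le_trans (le_normr_Rintegral _ di)) => //.
apply: (le_trans dB); rewrite mulrC -ler_pdivlMr//.
exact: le_trans (ler_norm _) Hn.
Qed.

Lemma Rintegral_norm_shift_ge Q (B c : R) (u : Lr) :
  {ae nu, forall x, u x = Q x + c} ->
  (forall x, a <= x <= b -> `|Q x| <= B) ->
  (`|c| - B) * (b - a) <= \int[nu]_x `|u x|.
Proof.
move=> uE QB.
have ui := Leb_integrable ab OE u.
have un : mfun (fun x => `|u x|).
  by apply: measurableT_comp => //; exact: Leb_measurable.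
have ba : 0 < b - a by rewrite subr_gt0.
have [cB|/ltW cB] := leP (`|c| - B) 0.
  apply: (@le_trans _ _ 0); first by rewrite pmulr_lle0.
  exact: Rintegral_ge0.
have unE : (\int[nu]_x `|u x|)%:E = (\int[nu]_x `|u x|%:E)%E.
  rewrite /Rintegral fineK// ge0_fin_numE; last exact: integral_ge0.
  by have /integrableP[] := ui.
rewrite -lee_fin unE.
rewrite (_ : ((`|c| - B) * (b - a))%:E = \int[nu]_x (`|c| - B)%:E)%E; last first.
  by rewrite integral_cst// (leb_setT oOmega ab OE).
apply: ae_ge0_le_integral => //.
- exact/measurable_EFinP.
apply/(ae_leb oOmega OE); move: uE => /(ae_leb oOmega OE).
apply: ae_imply => x h Ox _; rewrite lee_fin h// [Q x + c]addrC.
apply: le_trans (lerB_normD _ _); rewrite lerB// QB//.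
by move: Ox; rewrite OE/= in_itv/= => /andP[/ltW -> /ltW ->].
Qed.

Lemma pairing_shift_le Q (B c : R) (u : Lr) (lam : Ls) :
  {within `[a, b], continuous Q} ->
  {ae nu, forall x, u x = Q x + c} ->
  (forall x, a <= x <= b -> `|Q x| <= B) ->
  pairing oOmega lam u <= B * \int[nu]_x `|lam x| + c * \int[nu]_x lam x.
Proof.
move=> Qc uE QB; have mD := measurable_itvR `[a, b].
have Qcc : {within `[a, b], continuous (fun x => Q x + c)}.
  by move=> x; apply: cvgD; [exact: Qc|exact: cvg_cst].
rewrite (pairing_continuous OE _ (Leb_measurable u) Qcc uE).
have li := Leb_integ ab OE lam.
have lni : integ `[a, b] (fun x => `|lam x|) by exact: (integrable_norm li).
rewrite !(leb_RintegralE oOmega OE); last 2 first.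
- exact: Leb_measurable.
- by apply: measurableT_comp => //; exact: Leb_measurable.
rewrite -!RintegralZl// -RintegralD//; last 2 first.
- exact: (integrableZl mD B lni).
- exact: (integrableZl mD c li).
apply: le_Rintegral => //.
- exact: integrable_Leb_contM.
- exact: (integrableD mD (integrableZl mD B lni) (integrableZl mD c li)).
move=> x; rewrite /= in_itv/= => xab.
rewrite mulrDr [lam x * c]mulrC lerD2r.
by rewrite (le_trans (ler_norm _))// normrM mulrC ler_wpM2r// QB.
Qed.

(** The product with c states both tails at once: the integral of lambda is at least |M| + 1 for
    large positive c, and at most -(|M| + 1) for large negative c. *)
Lemma coercive_flux Lambda (sigma : R) Q U (M : R) : 1 <= sigma ->
  {within `[a, b], continuous Q} ->
  (forall c, {ae nu, forall x, U c x = Q x + c}) ->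
  sigma_coercive sigma Lambda -> sigma_bounded sigma Lambda ->
  exists2 C0 : R, 0 < C0 & forall c lam, C0 <= `|c| -> Lambda (U c) lam ->
    `|c| * (`|M| + 1) <= c * \int[nu]_x lam x.
Proof.
move=> sigma1 Qc HU [k kinf kP] [C C_gt0 CP].
have [B B0 QB] : exists2 B, 0 < B & forall x, a <= x <= b -> `|Q x| <= B.
  have /compact_bounded[B [_ HB]] := continuous_compact Qc (@segment_compact R a b).
  exists (`|B| + 1) => [|x xab]; first by rewrite ltr_wpDl.
  apply: HB; first by rewrite (le_lt_trans (ler_norm B))// ltrDl.
  by exists x; rewrite //= in_itv.
have [K K0 HK] := Lfun_Rintegral_le oOmega ab OE (conj_exp_gt1 hr).
have [K' K'0 HK'] := Lfun_Rintegral_le oOmega ab OE hr.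
have ba : 0 < b - a by rewrite subr_gt0.
(* half the rate at which the norm of Q + c grows with |c| *)
pose del := (b - a) / (2 * K').
have del0 : 0 < del by rewrite divr_gt0// mulr_gt0.
pose X := (`|M| + 1) / del.
have X0 : 0 < X by rewrite divr_gt0// ltr_wpDl.
(* The pairing with Q costs at most B K C (1 + N^sigma), hence at most 2 B K C N^sigma once N >= 1.
   The surplus [X] is tuned so that X N, with N >= |c| del, gives |c| (|M| + 1). *)
move/cvgryPge : kinf => /(_ (2 * (B * K * C) + X)) [N0 [_ HN0]].
(* At least 1, so that N <= N^sigma; strictly above [N0], since the coercivity bound is available
   only beyond it. *)
pose N1 := Num.max 1 (N0 + 1).
have N11 : 1 <= N1 by rewrite le_max lexx.
have N10 : 0 < N1 by exact: lt_le_trans N11.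
have N0N1 : N0 < N1 by rewrite lt_max ltrDl ltr01 orbT.
(* The first bound gives |c| - B >= |c| / 2, the second makes the norm of Q + c reach [N1]. *)
exists (Num.max (2 * B) (N1 / del)).
  by rewrite lt_max mulr_gt0.
move=> c lam; rewrite ge_max => /andP[cB cN] Ll.
set N := Lnrm oOmega r (U c).
have cN' : `|c| * del <= N.
  have [_ h1] := HK' _ (Leb_Lfun (U c)).
  have h2 := Rintegral_norm_shift_ge (HU c) QB.
  have h3 : `|c| / 2 * (b - a) <= K' * N.
    apply: le_trans h1; apply: le_trans h2; rewrite ler_wpM2r ?(ltW ba)//; lra.
  rewrite -ler_pdivrMl// in h3; apply: le_trans h3.
  by rewrite le_eqVlt; apply/orP; left; apply/eqP; rewrite /del; field; lra.
have N1N : N1 <= N.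
  by apply: le_trans cN'; rewrite -ler_pdivrMr.
have Npos : 0 < N by exact: lt_le_trans N1N.
have kN : 2 * (B * K * C) + X <= k N by apply: HN0; exact: lt_le_trans N1N.
set P := N `^ sigma.
have NP : N <= P.
  rewrite -[X in X <= _](powRr1 (ltW Npos)) /P ler_powR//.
  exact: le_trans N1N.
have P1 : 1 <= P by apply: le_trans NP; exact: le_trans N1N.
have [_ lamK] := HK _ (Leb_Lfun lam).
have := kP _ _ Ll; rewrite -/N -/P => h1.
have := CP _ _ Ll; rewrite -/N -/P => h2.
have h3 := pairing_shift_le lam Qc (HU c) QB.
have h4 : \int[nu]_x `|lam x| <= K * (C * (1 + P)).
  by apply: (le_trans lamK); rewrite ler_pM2l.
have h5 : B * \int[nu]_x `|lam x| <= B * (K * (C * (1 + P))) by rewrite ler_pM2l.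
have h6 : (2 * (B * K * C) + X) * P <= k N * P by rewrite ler_wpM2r//; lra.
have BKC : 0 < B * K * C by rewrite !mulr_gt0.
have h7 : B * K * C * 1 <= B * K * C * P by rewrite ler_pM2l.
have h8 : X * N <= X * P by rewrite ler_pM2l.
have h9 : X * (`|c| * del) <= X * N by rewrite ler_pM2l.
have h10 : X * (`|c| * del) = `|c| * (`|M| + 1).
  by rewrite /X; field; rewrite gt_eqF.
rewrite -h10; lra.
Qed.

(** The integrals over one convex set of drags form an interval; the weight t solves t m1 + (1 - t)
    m2 = M. *)
Lemma convex_flux Lambda (u : Lr) (lam1 lam2 : Ls) (M : R) :
  convex_subset (Lambda u) -> Lambda u lam1 -> Lambda u lam2 ->
  \int[nu]_x lam1 x <= M -> M <= \int[nu]_x lam2 x ->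
  exists2 lam, Lambda u lam & \int[nu]_x lam x = M.
Proof.
move=> conv L1 L2; set m1 := \int[nu]_x lam1 x; set m2 := \int[nu]_x lam2 x.
rewrite le_eqVlt => /predU1P[m1M _|m1M Mm2]; first by exists lam1.
have d0 : 0 < m2 - m1 by lra.
pose t := (m2 - M) / (m2 - m1).
have t01 : 0 <= t <= 1.
  apply/andP; split; first by apply: divr_ge0; lra.
  by rewrite /t ler_pdivrMr//; lra.
have combL : (fun x => t * lam1 x + (1 - t) * lam2 x) \in Lfun nu s%:E.
  apply: (Lfun_add (conj_gt1_leE hr));
  by apply: (Lfun_scalel (conj_gt1_leE hr)); exact: Leb_Lfun.
have [lam lamE] := Lfun_Leb (conj_gt1_leE hr) combL.
exists lam; first exact: conv L1 L2 t01 lamE.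
have i1 := Leb_integrable ab OE lam1; have i2 := Leb_integrable ab OE lam2.
transitivity (\int[nu]_x (t * lam1 x + (1 - t) * lam2 x)).
  rewrite /Rintegral; congr fine; apply: ae_eq_integral => //.
  - by apply/measurable_EFinP; exact: Leb_measurable.
  - by apply/measurable_EFinP; have /mem_LfunP[] := combL.
  - by apply: ae_imply lamE => x -> _.
rewrite RintegralD//.
- rewrite !RintegralZl// -/m1 -/m2 /t; field; lra.
- exact: (integrableZl measurableT t i1).
- exact: (integrableZl measurableT (1 - t) i2).
Qed.

(* Set-continuity only yields some convergent selection; since, for a
   contradiction, no set Lambda (U c) meets both sides of M, any selection stays
   on the side of c, so that the sets of low and high constants are both closed. *)
Lemma flux_selection Lambda (sigma : R) Q (M : R) : 1 <= sigma ->
  {within `[a, b], continuous Q} -> (forall u, Lambda u !=set0) ->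
  set_continuous Lambda -> (forall u, convex_subset (Lambda u)) ->
  sigma_coercive sigma Lambda -> sigma_bounded sigma Lambda ->
  exists (c : R) (u : Lr) (lam : Ls), [/\ {ae nu, forall x, u x = Q x + c},
    Lambda u lam & \int[nu]_x lam x = M].
Proof.
move=> sigma1 Qc L0 Lc Lconv coer bdd.
have /choice [U HU] : forall c : R, exists u : Lr, {ae nu, forall x, u x = Q x + c}.
  move=> c; apply: (continuous_Leb oOmega ab OE).
  by move=> x; apply: cvgD; [exact: Qc|exact: cvg_cst].
have [C0 C00 HC] := coercive_flux M sigma1 Qc HU coer bdd.
apply: contrapT => nex.
have nE c lam : Lambda (U c) lam -> \int[nu]_x lam x <> M.
  by move=> Ll lM; apply: nex; exists c, (U c), lam; split.
pose low := [set c | exists2 lam, Lambda (U c) lam & \int[nu]_x lam x <= M].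
pose high := [set c | exists2 lam, Lambda (U c) lam & M <= \int[nu]_x lam x].
have disj c : low c -> high c -> False.
  move=> [l1 L1 I1] [l2 L2 I2].
  by have [lam /nE] := convex_flux (Lconv (U c)) L1 L2 I1 I2.
have tot c : low c \/ high c.
  have [lam Ll] := L0 (U c).
  by have [h|/ltW h] := leP (\int[nu]_x lam x) M; [left|right]; exists lam.
(* The tail estimate puts every drag at - C0 below M, so [low] is nonempty; likewise [highP] bounds
   it above by [C0]. *)
have lowN : low (- C0).
  have [//|[lam Ll h]] := tot (- C0).
  have := HC _ _ _ Ll; rewrite normrN gtr0_norm// lexx => /(_ isT).
  rewrite mulNr -mulrN ler_pM2l// => h'; exists lam => //.
  have := ler_norm (- M); rewrite normrN; lra.
have highP c : C0 <= c -> high c.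
  move=> Cc; have c0 : 0 < c by exact: lt_le_trans Cc.
  have [[lam Ll h]|//] := tot c.
  have := HC c lam _ Ll; rewrite gtr0_norm// => /(_ Cc).
  rewrite ler_pM2l// => h'; exists lam => //.
  have := ler_norm M; lra.
have hs : has_sup low.
  split; first by exists (- C0).
  exists C0 => c lc; rewrite leNgt; apply/negP => /ltW /highP; exact: disj lc.
pose z := sup low.
have closed_low (c_ : nat -> R) : (forall n, low (c_ n)) -> c_ n @[n --> \oo] --> z -> low z.
  move=> lc cz; have [lam_ [lam [L1 L2 /Leb_cvg_Rintegral L3]]] := Lc _ _ (Leb_cvg_shift HU cz).
  exists lam => //; apply: (closed_cvg (fun y => y <= M) _ _ _ L3).
  - exact: closed_le.
  - by apply: nearW => n; rewrite leNgt; apply/negP => /ltW h; apply: (disj (c_ n)) => //; exists (lam_ n).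
have closed_high (c_ : nat -> R) : (forall n, high (c_ n)) -> c_ n @[n --> \oo] --> z -> high z.
  move=> lc cz; have [lam_ [lam [L1 L2 /Leb_cvg_Rintegral L3]]] := Lc _ _ (Leb_cvg_shift HU cz).
  exists lam => //; apply: (closed_cvg (fun y => M <= y) _ _ _ L3).
  - exact: closed_ge.
  - by apply: nearW => n; rewrite leNgt; apply/negP => /ltW h; apply: (disj (c_ n)) => //; exists (lam_ n).
(* The supremum z is a limit of low constants, and also of the constants z + 1/(n+1), which exceed
   the supremum and are therefore high; closedness puts z on both sides. *)
apply: (disj z).
  have /choice [c_ Hc] : forall n, exists c, low c /\ z - n.+1%:R^-1 < c.
    move=> n; have n0 : 0 < n.+1%:R^-1 :> R by rewrite invr_gt0.
    by have [c lc h] := sup_adherent n0 hs; exists c.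
  apply: (closed_low c_); first by move=> n; have [] := Hc n.
  apply: (@squeeze_cvgr _ _ _ _ (fun n => z - n.+1%:R^-1) (fun=> z)).
  - by apply: nearW => n; have [l1 l2] := Hc n; rewrite ltW//= ub_le_sup//; exact: hs.2.
  - rewrite -[X in _ --> X]subr0; apply: cvgB; first exact: cvg_cst.
    exact: cvg_harmonic.
  - exact: cvg_cst.
apply: (closed_high (fun n => z + n.+1%:R^-1)).
  move=> n; have [lz|//] := tot (z + n.+1%:R^-1).
  have := ub_le_sup hs.2 lz; rewrite leNgt ltrDl invr_gt0 ltr0n //.
rewrite -[X in _ --> X]addr0; apply: cvgD; first exact: cvg_cst.
exact: cvg_harmonic.
Qed.

End selection.

(** * The two regimes: velocity prescribed at some endpoint, or pressure at both *)

Theorem theorem3p5 (R : realType)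
  (Omega : set R) (oOmega : open Omega) (bOmega : bounded_set Omega)
  (nOmega : Omega !=set0) (cOmega : connected Omega)
  (lOmega : lipschitz_boundary Omega)
  (Sigma_v Sigma_p : set R)
  (oSigma_v : relatively_open (boundary Omega) Sigma_v)
  (oSigma_p : relatively_open (boundary Omega) Sigma_p)
  (cover : boundary Omega = closure (Sigma_v `|` Sigma_p))
  (disj : Sigma_v `&` Sigma_p = set0)
  (r : R) (hr : 1 < r)
  (q : Leb oOmega (gt1_leE hr)) (f : Leb oOmega (conj_gt1_leE hr))
  (u0 : R -> R) (hu0 : mem_Lp0 Sigma_v r u0)
  (p0 : R -> R) (hp0 : mem_W0dim Sigma_p r^-1 (conj_exp r) p0)
  (E : (R -> R) -> W1 oOmega (conj_gt1_leE hr))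
  (hE : extension_operator Sigma_p E)
  (Lambda : Leb oOmega (gt1_leE hr) -> set (Leb oOmega (conj_gt1_leE hr)))
  (hLambda : forall u, Lambda u !=set0) :
  let P := problemP Sigma_v Sigma_p Lambda q f u0 p0 E in
  ((0 < Vol0 Sigma_v)%E ->
     exists u p,
       [/\ P u p,
           forall u' p', P u' p' -> u' = u &
           monovalued Lambda -> forall u' p', P u' p' -> p' = p]) /\
  (Vol0 Sigma_v = 0%E ->
     set_continuous Lambda ->
     (forall u, convex_subset (Lambda u)) ->
     (exists2 sigma : R, 1 <= sigma &
        sigma_coercive sigma Lambda /\ sigma_bounded sigma Lambda) ->
     exists u p, P u p).
Proof.
have [a [b [ab OE]]] := open_bounded_connectedE oOmega bOmega nOmega cOmega.
have bE : boundary Omega = [set a; b] by rewrite OE boundary_itv.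
have vab : Sigma_v `<=` [set a; b].
  by case: oSigma_v => V _ ->; rewrite bE => x [].
have pab : Sigma_p `<=` [set a; b].
  by case: oSigma_p => V _ ->; rewrite bE => x [].
(* The union of the two parts lies in a two-point set, hence is closed, so the closure in [cover]
   adds nothing. *)
have vp x : x = a \/ x = b -> Sigma_v x \/ Sigma_p x.
  have cl : closed (Sigma_v `|` Sigma_p).
    have := @accessible_finite_set_closed R; case=> + _.
    apply; first by apply: hausdorff_accessible; exact: Rhausdorff.
    by apply: (sub_finite_set _ (finite_set2 a b)) => y [/vab|/pab].
  move=> xab; have : boundary Omega x by rewrite bE.
  by rewrite cover; move/closure_id : cl => <-.
have nvp x : Sigma_v x -> Sigma_p x -> False.
  by move=> vx px; have : (Sigma_v `&` Sigma_p) x by []; rewrite disj.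
pose F := f0 Sigma_p f p0 E.
have FL : F \in Lfun (leb oOmega) (conj_exp r)%:E.
  rewrite /F /f0; case: ifP => _; first exact: Leb_Lfun.
  rewrite (_ : (fun x => _) = fun x => f x + -1 * W1_der (E p0) x).
    apply: (Lfun_add (conj_gt1_leE hr)); first exact: Leb_Lfun.
    by apply: (Lfun_scalel (conj_gt1_leE hr)); exact: Leb_Lfun.
  by apply/funext => x; rewrite mulN1r.
have flux (p' : W1 oOmega (conj_gt1_leE hr)) (lam' : Leb oOmega (conj_gt1_leE hr)) :
    (forall phi : Leb oOmega (gt1_leE hr), pairing oOmega lam' phi =
      pairing oOmega (fun x => - W1_der p' x + F x) phi) <->
    {ae leb oOmega, forall x, W1_der p' x = F x - lam' x}.
  exact: (pressure_flux ab OE).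
move=> P; split.
  move=> v0; have {}v0 : Sigma_v !=set0.
    apply/set0P/negP => v0'; move: v0; rewrite lt_def Vol0_eq0 => /andP[/negP].
    by [].
  (* An endpoint in Sigma_v escapes Sigma_p, so the constraint on psi is a single linear condition,
     the form that the kernel expresses. *)
  have npab : ~ (Sigma_p a /\ Sigma_p b).
    move=> [pa pb]; have [z vz] := v0.
    by have [zE|zE] := vab _ vz; apply: (nvp z) => //; rewrite zE.
  have [kappa kc Hk] := W1_0_kernel oOmega ab OE (conj_gt1_leE hr) pab npab.
  have [U Uc HU] := W1_0_velocity ab OE q u0 vab kc Hk.
  have [u uU] := continuous_Leb oOmega ab OE (gt1_leE hr) Uc.
  have [lam Ll] := hLambda u.
  have [p pE tE] := pressure_exists ab OE lam FL
    (fun g => - \int[lebesgue_measure]_(x in `[a, b]) (g x * kappa x)).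
  have uniq u' p' : P u' p' -> u' = u.
    move=> [_ [lam' [_ _ Hu']]]; apply: Leb_eqP.
    have : {ae leb oOmega, forall x, u' x = U x}.
      apply: (velocity_unique ab OE Uc Hk) => psi psi0.
      by rewrite Hu'// HU.
    by move=> u'U; apply: ae_imply2 u'U uU => x -> ->.
  exists u, p; split.
  - split; first exact/Hk.
    exists lam; split => //; first exact/flux.
    move=> psi psi0; rewrite HU//.
    by rewrite (pairing_continuous OE _ (Leb_measurable u) Uc uU).
  - exact: uniq.
  - move=> mono u' p' P'; have uE := uniq _ _ P'.
    move: P' => [p'0 [lam' [Ll' /flux p'E _]]].
    rewrite uE in Ll'.
    have lE : lam' = lam.
      by have [l lE] := mono u; move: Ll Ll'; rewrite lE => -> ->.
    have dE : W1_der p' = W1_der p.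
      by apply: Leb_eqP; apply: ae_imply2 p'E pE => x -> ->; rewrite lE.
    apply: (W1_ext ab OE) => //.
    by rewrite tE ((Hk _).1 p'0) dE.
move=> v0 Lc Lconv [sigma sigma1 [coer bdd]].
have {}v0 : Sigma_v = set0 by apply/eqP; rewrite -Vol0_eq0; apply/eqP.
have pE : Sigma_p = [set a; b].
  apply/seteqP; split => // x xab.
  by have := vp x xab; rewrite v0 => -[].
pose Q := prim a q.
have Qc : {within `[a, b], continuous Q} by exact: prim_Leb_continuous.
have [c [u [lam [uE Ll lM]]]] := flux_selection ab OE
  (\int[leb oOmega]_x F x) sigma1 Qc hLambda Lc Lconv coer bdd.
have [p pdE tE] := pressure_exists ab OE lam FL (fun=> 0).
exists u, p; split.
  rewrite pE; apply/(W1_0_dirichlet ab OE); split => //.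
  have li := Leb_integrable ab OE lam.
  have Fi := Lfun_leb_integrable ab OE (conj_gt1_leE hr) FL.
  have [mF _] := (mem_LfunP _ _ _).1 FL.
  rewrite /prim -(leb_RintegralE oOmega OE (Leb_measurable _)).
  transitivity (\int[leb oOmega]_x (F x - lam x)).
    rewrite /Rintegral; congr fine; apply: ae_eq_integral => //.
    - by apply/measurable_EFinP; exact: Leb_measurable.
    - apply/measurable_EFinP; apply: measurable_funB => //; exact: Leb_measurable.
    - by apply: ae_imply pdE => x ->.
  by rewrite RintegralB// lM subrr.
exists lam; split => //; first exact/flux.
move=> psi; rewrite {1}pE => psi0.
have /(W1_0_dirichlet ab OE)[ta pb] := psi0.
rewrite (W1_0_load ab OE _ _ _ vab) ta pb !mul0r !add0r.
set g := W1_der psi in pb *.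
have Uc : {within `[a, b], continuous (fun x => Q x + c)}.
  by move=> x; apply: cvgD; [exact: Qc|exact: cvg_cst].
rewrite (pairing_continuous OE _ (Leb_measurable u) Uc uE).
have gi := Leb_integ ab OE g.
have mD := measurable_itvR `[a, b].
(* The missing 0 is written as c times the integral of psi', which vanishes for admissible psi; this
   is why the constant c is invisible to the continuity equation. *)
rewrite -[RHS]addr0 -[X in _ + X](mulr0 c) -pb -(RintegralZ_prim ab OE) -RintegralD//.
- by apply: eq_Rintegral => x _; rewrite /Q; ring.
- exact: integrable_Leb_contM.
- exact: (integrableZl mD c gi).
Qed.
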